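(* Let $\Gamma,\tilde\Gamma$ be groups, and let $\alpha_0,\alpha_1\in\mathrm{Aut}(\Gamma)$ and $\tilde\alpha_0,\tilde\alpha_1\in\mathrm{Aut}(\tilde\Gamma)$ be automorphisms. Let $G=L\Gamma\rtimes V$ and $\tilde G=L\tilde\Gamma\rtimes V$ be the fraction groups associated to $(\Gamma,\alpha_0,\alpha_1)$ and $(\tilde\Gamma,\tilde\alpha_0,\tilde\alpha_1)$ respectively. Then: (1) If $G\simeq\tilde G$, then $\Gamma\simeq\tilde\Gamma$. (2) Assume that $\tilde\alpha_0,\tilde\alpha_1$ are inner automorphisms. Then $G\simeq\tilde G$ if and only if $\Gamma\simeq\tilde\Gamma$ and $\alpha_0,\alpha_1$ are inner automorphisms.
   Context: Let $\mathfrak C=\{0,1\}^{\mathbf N}$ be the Cantor space (product topology). A standard dyadic interval (sdi) is a set $I=\{m_I\cdot y: y\in\mathfrak C\}$ of all sequences with a given finite prefix $m_I$ (a finite word in $0,1$, called the word of $I$). A standard dyadic partition (sdp) is a finite partition of $\mathfrak C$ into sdi. Thompson's group $V$ is the group of homeomorphisms $v$ of $\mathfrak C$ for which there are two sdp $(I_k)_{1\le k\le n}$, $(J_k)_{1\le k\le n}$ with $v(m_{I_k}\cdot x)=m_{J_k}\cdot x$ for all $1\le k\le n$, $x\in\mathfrak C$. An sdi $I$ is adapted to $v\in V$ if there is a finite word $m$ with $v(m_I\cdot x)=m\cdot x$ for all $x\in\mathfrak C$; then $v(I)$ is the sdi with word $m$. Let $\Gamma$ be a group and $\alpha_0,\alpha_1\in\mathrm{Aut}(\Gamma)$.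 For a finite word $m=l_1\cdots l_n$ in $0,1$ put $\alpha_m=\alpha_{l_n}\circ\cdots\circ\alpha_{l_1}$ (identity for the empty word), and for an sdi $I$ put $\alpha_I=\alpha_{m_I}$. The discrete loop group $L\Gamma$ is the group, under pointwise multiplication, of maps $a:\mathfrak C\to\Gamma$ that are locally constant, i.e. constant on each piece of some sdp. For $v\in V$, $x\in\mathfrak C$ put $\tau_{v,x}=\alpha_{v(I)}^{-1}\circ\alpha_I$ where $I$ is any sdi containing $x$ and adapted to $v$ (this does not depend on $I$). The Jones action $\pi:V\to\mathrm{Aut}(L\Gamma)$ is $\pi_v(a)(vx)=\tau_{v,x}(a(x))$. The fraction group associated to $(\Gamma,\alpha_0,\alpha_1)$ is the semidirect product $L\Gamma\rtimes V$ for this action (so $vav^{-1}=\pi_v(a)$). *)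

(* Defs.v *)
From HB Require Import structures.
From mathcomp Require Import all_boot.
From mathcomp Require Import mathcomp_extra boolp classical_sets functions.
From mathcomp Require Import topology cantor.

Set Implicit Arguments.
Unset Strict Implicit.
Unset Printing Implicit Defensive.

Local Open Scope classical_set_scope.
Local Open Scope group_scope.

Definition isomorphic (G H : groupType) : Prop :=
  exists f : {multiplicative G -> H}, bijective f.

Section Automorphisms.
Variable G : groupType.

(* The inverse map is determined by [aut_fun]; storing it avoids choosing it
   when forming inverses. *)
Record automorphism := Automorphism {
  aut_fun :> G -> G;
  aut_inv : G -> G;
  aut_mul : {morph aut_fun : x y / x * y};
  aut_funK : cancel aut_fun aut_inv;
  aut_invK : cancel aut_inv aut_fun
}.

Lemma automorphism_eq (f g : automorphism) : (forall x, f x = g x) -> f = g.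
Proof.
case: f g => [f f' fM fK f'K] [g g' gM gK g'K] /= /funext fg.
subst g; have : f' = g' by apply: funext => x; rewrite -{1}(g'K x) fK.
move=> ?; subst g'; congr Automorphism; exact: Prop_irrelevance.
Qed.

HB.instance Definition _ := gen_eqMixin automorphism.
HB.instance Definition _ := gen_choiceMixin automorphism.

Definition aut_id : automorphism :=
  @Automorphism id id (fun _ _ => erefl) (fun _ => erefl) (fun _ => erefl).

Lemma aut_inv_mul (f : automorphism) : {morph aut_inv f : x y / x * y}.
Proof.
by move=> x y; rewrite -{1}(aut_invK f x) -{1}(aut_invK f y) -aut_mul aut_funK.
Qed.

Definition aut_sym (f : automorphism) : automorphism :=
  Automorphism (aut_inv_mul f) (aut_invK f) (aut_funK f).

Lemma aut_comp_mul (f g : automorphism) : {morph f \o g : x y / x * y}.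
Proof. by move=> x y /=; rewrite !aut_mul. Qed.

Definition aut_comp (f g : automorphism) : automorphism :=
  Automorphism (aut_comp_mul f g)
    (can_comp (aut_funK f) (aut_funK g)) (can_comp (aut_invK g) (aut_invK f)).

Lemma aut_compA : associative aut_comp.
Proof. by move=> f g h; apply: automorphism_eq. Qed.
Lemma aut_comp1f : left_id aut_id aut_comp.
Proof. by move=> f; apply: automorphism_eq. Qed.
Lemma aut_compf1 : right_id aut_id aut_comp.
Proof. by move=> f; apply: automorphism_eq. Qed.
Lemma aut_compVf : left_inverse aut_id aut_sym aut_comp.
Proof. by move=> f; apply: automorphism_eq => x /=; rewrite aut_funK. Qed.
Lemma aut_compfV : right_inverse aut_id aut_sym aut_comp.
Proof. by move=> f; apply: automorphism_eq => x /=; rewrite aut_invK. Qed.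

HB.instance Definition _ := isGroup.Build automorphism
  aut_compA aut_comp1f aut_compf1 aut_compVf aut_compfV.

Lemma aut_mulE (f g : automorphism) x : (f * g) x = f (g x).
Proof. by []. Qed.

HB.instance Definition _ (f : automorphism) :=
  isMultiplicative.Build G G (aut_fun f) (@aut_mul f).

Definition inner (f : automorphism) : Prop :=
  exists g : G, forall x, f x = g * x * g^-1.

End Automorphisms.

(* The carrier does not depend on phi, but the group structure does: phi is a
   parameter of the type so that the structure can be inferred from it. *)
Record semidirect (N Q : groupType)
    (phi : {multiplicative Q -> automorphism N}) :=
  Semidirect { sd_left : N; sd_right : Q }.

Section SemidirectProduct.
Variables (N Q : groupType) (phi : {multiplicative Q -> automorphism N}).

Local Notation Semidirect := (@Semidirect N Q phi).

HB.instance Definition _ := gen_eqMixin (semidirect phi).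
HB.instance Definition _ := gen_choiceMixin (semidirect phi).

Definition sd_one : semidirect phi := Semidirect 1 1.
Definition sd_mul (u w : semidirect phi) : semidirect phi :=
  Semidirect (sd_left u * phi (sd_right u) (sd_left w))
             (sd_right u * sd_right w).
Definition sd_inv (u : semidirect phi) : semidirect phi :=
  Semidirect (phi (sd_right u)^-1 (sd_left u)^-1) (sd_right u)^-1.

Let aut1 (f : automorphism N) : f 1 = 1.
Proof. by apply: (mulgI (f 1)); rewrite -aut_mul !mulg1. Qed.
Let phi1 : phi 1 = 1.
Proof. by apply: (mulgI (phi 1)); rewrite -gmulfM !mulg1. Qed.

Lemma sd_mulA : associative sd_mul.
Proof.
move=> [a v] [b w] [c u]; congr Semidirect => /=; last exact: mulgA.
by rewrite aut_mul gmulfM aut_mulE mulgA.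
Qed.
Lemma sd_mul1u : left_id sd_one sd_mul.
Proof. by move=> [a v]; congr Semidirect => /=; rewrite ?phi1 mul1g. Qed.
Lemma sd_mulu1 : right_id sd_one sd_mul.
Proof. by move=> [a v]; congr Semidirect => /=; rewrite ?aut1 mulg1. Qed.
Lemma sd_mulVu : left_inverse sd_one sd_inv sd_mul.
Proof.
by move=> [a v]; congr Semidirect => /=; rewrite -?aut_mul mulVg ?aut1.
Qed.
Lemma sd_muluV : right_inverse sd_one sd_inv sd_mul.
Proof.
move=> [a v]; congr Semidirect => /=; last by rewrite mulgV.
by rewrite -aut_mulE -gmulfM mulgV phi1 mulgV.
Qed.

HB.instance Definition _ := isGroup.Build (semidirect phi)
  sd_mulA sd_mul1u sd_mulu1 sd_mulVu sd_muluV.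

Lemma sd_conj (v : Q) (a : N) :
  Semidirect 1 v * Semidirect a 1 * (Semidirect 1 v)^-1
    = Semidirect (phi v a) 1.
Proof.
congr Semidirect => /=; last by rewrite mulg1 mulgV.
by rewrite invg1 !aut1 mul1g mulg1.
Qed.

End SemidirectProduct.

(* Finite words are sequences of booleans ([false] is 0, [true] is 1). A
   standard dyadic interval (sdi) is handled through its word: each determines
   the other. A standard dyadic partition (sdp) is the family of the words of
   its pieces. *)

(* The infinite word m . y. *)
Definition prepend (m : seq bool) (y : cantor_space) : cantor_space :=
  fun n => nth (y (n - size m)%N) m n.

Definition sdi (m : seq bool) : set cantor_space := range (prepend m).

Definition is_sdp n (m : 'I_n -> seq bool) : Prop :=
  partition [set: 'I_n] (fun k => sdi (m k)) [set: cantor_space].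

(* The sdi of word m is adapted to v, with image the sdi of word m'. *)
Definition adapted (v : cantor_space -> cantor_space) (m m' : seq bool) : Prop :=
  forall x, v (prepend m x) = prepend m' x.

Section Words.
Implicit Types (m p q r : seq bool) (x y : cantor_space).

Lemma prepend_nil x : prepend [::] x = x.
Proof. by apply: funext => n; rewrite /prepend nth_nil subn0. Qed.

Lemma prepend_cat m p x : prepend (m ++ p) x = prepend m (prepend p x).
Proof.
apply: funext => n; rewrite /prepend nth_cat size_cat subnDA.
by case: ltnP => // nm; [exact: set_nth_default | rewrite [RHS]nth_default].
Qed.

Lemma mkseq_prepend m x : mkseq (prepend m x) (size m) = m.
Proof.
apply: (@eq_from_nth _ false); rewrite size_mkseq // => i im.
by rewrite nth_mkseq // /prepend; exact: set_nth_default.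
Qed.

Lemma prepend_mkseq N x : prepend (mkseq x N) (fun n => x (N + n)%N) = x.
Proof.
apply: funext => n; rewrite /prepend size_mkseq.
case: (ltnP n N) => nN; first by rewrite nth_mkseq.
by rewrite nth_default ?size_mkseq // subnKC.
Qed.

Lemma prepend_inj m : injective (prepend m).
Proof.
move=> x y exy; apply: funext => n.
have /(congr1 (fun f : cantor_space => f (size m + n)%N)) := exy.
by rewrite /prepend !nth_default ?leq_addr // addKn.
Qed.

Lemma prepend_eq m p x y : prepend m x = prepend p y -> (size m <= size p)%N ->
  exists r, p = m ++ r /\ x = prepend r y.
Proof.
move=> e le; have ep : p = m ++ drop (size m) p.
  rewrite -{1}(cat_take_drop (size m) p); congr (_ ++ _).
  rewrite -[RHS](mkseq_prepend m x) e -{1}(mkseq_prepend p y).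
  by rewrite /mkseq -map_take take_iota (minn_idPl le).
exists (drop (size m) p); split=> //.
by apply: (@prepend_inj m); rewrite -prepend_cat -ep.
Qed.

Lemma prepend_eq_size m p x y :
  prepend m x = prepend p y -> size m = size p -> m = p.
Proof.
by move=> e s; rewrite -(mkseq_prepend m x) e s mkseq_prepend.
Qed.

Lemma prepend_word_inj m p : (forall x, prepend m x = prepend p x) -> m = p.
Proof.
wlog le : m p / (size m <= size p)%N => [hw|] e.
  by case/orP: (leq_total (size m) (size p)) => ?; [|symmetry]; apply: hw.
have [r [ep _]] := prepend_eq (e (fun=> false)) le.
have er x : x = prepend r x.
  by apply: (@prepend_inj m); rewrite -prepend_cat -ep.
case: r ep er => [|b r] ep er; first by rewrite ep cats0.
have /(congr1 (fun f : cantor_space => f 0%N)) := er (fun=> ~~ b).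
by rewrite /prepend /=; case: b {ep er}.
Qed.

Lemma sdi_mkseq N x : sdi (mkseq x N) x.
Proof. by exists (fun n => x (N + n)%N) => //; rewrite prepend_mkseq. Qed.

Lemma is_sdp_fin (T : finType) (m : T -> seq bool) :
  partition [set: T] (fun t => sdi (m t)) [set: cantor_space] ->
  is_sdp (fun k : 'I_#|T| => m (enum_val k)).
Proof.
case=> cov tri ne; split.
- apply/seteqP; split=> // x _; have : cover [set: T] (fun t => sdi (m t)) x.
    by rewrite cov.
  by case=> t _ xt; exists (enum_rank t) => //; rewrite enum_rankK.
- by move=> i j _ _ /tri e; apply: enum_val_inj; apply: e.
- by move=> i _; apply: ne.
Qed.

Lemma sdi_neq0 m : sdi m !=set0.
Proof. by exists (prepend m (fun=> false)); exists (fun=> false). Qed.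

Lemma is_sdp_level N : is_sdp (fun k : 'I_#|{: N.-tuple bool}| => tval (enum_val k)).
Proof.
apply: (is_sdp_fin (m := fun t : N.-tuple bool => t)); split.
- apply/seteqP; split=> // x _.
  have sN : size (mkseq x N) == N by rewrite size_mkseq.
  by exists (Tuple sN) => //=; exact: sdi_mkseq.
- move=> s t _ _ [x [[y _ ey] [z _ ez]]]; apply: val_inj.
  by apply: (@prepend_eq_size _ _ y z); rewrite ?ey ?ez // !size_tuple.
- by move=> t _; exact: sdi_neq0.
Qed.

Lemma is_sdp_bound n (m : 'I_n -> seq bool) : is_sdp m ->
  exists N, forall p, (N <= size p)%N -> exists k r, p = m k ++ r.
Proof.
case=> cov _ _; exists (\max_(k < n) size (m k))%N => p le.
have : cover [set: 'I_n] (fun k => sdi (m k)) (prepend p (fun=> false)).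
  by rewrite cov.
case=> k _ [y _ e]; exists k.
have [|r [ep _]] := prepend_eq e; last by exists r.
by apply: leq_trans le; exact: (leq_bigmax (F := fun k => size (m k))).
Qed.

End Words.

Section ThompsonGroup.

Definition sdp_map (v : cantor_space -> cantor_space) : Prop :=
  exists n (I J : 'I_n -> seq bool),
    [/\ is_sdp I, is_sdp J & forall k, adapted v (I k) (J k)].

Record thompsonV := ThompsonV {
  tv_fun :> cantor_space -> cantor_space;
  tv_inv : cantor_space -> cantor_space;
  tv_funK : cancel tv_fun tv_inv;
  tv_invK : cancel tv_inv tv_fun;
  tv_fun_continuous : continuous tv_fun;
  tv_inv_continuous : continuous tv_inv;
  tv_sdp_map : sdp_map tv_fun
}.

Lemma thompsonV_eq (v w : thompsonV) : (forall x, v x = w x) -> v = w.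
Proof.
case: v w => [f f' fK f'K fc f'c fs] [g g' gK g'K gc g'c gs] /= /funext fg.
subst g; have : f' = g' by apply: funext => x; rewrite -{1}(g'K x) fK.
move=> ?; subst g'; congr ThompsonV; exact: Prop_irrelevance.
Qed.

HB.instance Definition _ := gen_eqMixin thompsonV.
HB.instance Definition _ := gen_choiceMixin thompsonV.

Lemma sdp_map_level v : sdp_map v ->
  exists N, forall m, (N <= size m)%N -> exists m', adapted v m m'.
Proof.
case=> n [I [J [sI _ IJ]]]; have [N HN] := is_sdp_bound sI.
exists N => m /HN[k [r ->]]; exists (J k ++ r) => x.
by rewrite !prepend_cat IJ.
Qed.

Lemma level_sdp_map v v' N : cancel v v' -> cancel v' v ->
  (forall m, size m = N -> exists m', adapted v m m') -> sdp_map v.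
Proof.
move=> vK v'K ad.
have [f Hf] : {f : N.-tuple bool -> seq bool &
    forall t : N.-tuple bool, adapted v t (f t)}.
  apply: (@choice _ _ (fun t : N.-tuple bool => adapted v t)) => t.
  by apply: ad; rewrite size_tuple.
exists #|{: N.-tuple bool}|, (fun k => tval (enum_val k)), (fun k => f (enum_val k)).
split=> [||k]; [exact: is_sdp_level | | exact: Hf].
have [cov tri _] := is_sdp_level N.
apply: is_sdp_fin; split.
- apply/seteqP; split=> // x _.
  have : cover [set: 'I_#|{: N.-tuple bool}|] (fun k => sdi (tval (enum_val k))) (v' x).
    by rewrite cov.
  case=> k _ [y _ e]; exists (enum_val k) => //; exists y => //.
  by rewrite -Hf e v'K.
- move=> s t _ _ [x [[y _ ey] [z _ ez]]]; apply: val_inj.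
  apply: (@prepend_eq_size _ _ y z); last by rewrite !size_tuple.
  by apply: (can_inj vK); rewrite !Hf ey ez.
- by move=> t _; exact: sdi_neq0.
Qed.

Lemma adapted_comp (v w : cantor_space -> cantor_space) :
  sdp_map v -> sdp_map w ->
  exists N, forall m, size m = N ->
    exists m' m'', adapted w m m' /\ adapted v m' m''.
Proof.
move=> /sdp_map_level[N1 H1] /sdp_map_level[N2 H2].
exists (N2 + N1)%N => m sm.
have [|p Hp] := H2 (take N2 m); first by rewrite size_takel // sm leq_addr.
have [|q Hq] := H1 (p ++ drop N2 m).
  by rewrite size_cat size_drop sm addKn leq_addl.
exists (p ++ drop N2 m), q; split=> // x.
by rewrite -{1}(cat_take_drop N2 m) !prepend_cat Hp.
Qed.

Lemma tv_one_sdp : sdp_map id.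
Proof. by apply: (@level_sdp_map id id 0) => // m _; exists m. Qed.

Definition tv_one : thompsonV :=
  @ThompsonV id id (fun=> erefl) (fun=> erefl)
    (fun x => cvg_id) (fun x => cvg_id) tv_one_sdp.

Lemma tv_sym_sdp (v : thompsonV) : sdp_map (tv_inv v).
Proof.
have [n [I [J [sI sJ IJ]]]] := tv_sdp_map v.
by exists n, J, I; split=> // k x; rewrite -IJ tv_funK.
Qed.

Definition tv_sym (v : thompsonV) : thompsonV :=
  ThompsonV (@tv_invK v) (@tv_funK v)
    (@tv_inv_continuous v) (@tv_fun_continuous v) (tv_sym_sdp v).

Section Comp.
Variables v w : thompsonV.

Let compK : cancel (v \o w) (tv_inv w \o tv_inv v).
Proof. exact: can_comp (@tv_funK v) (@tv_funK w). Qed.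
Let compVK : cancel (tv_inv w \o tv_inv v) (v \o w).
Proof. exact: can_comp (@tv_invK w) (@tv_invK v). Qed.

Lemma tv_comp_continuous : continuous (v \o w).
Proof.
by move=> x; apply: continuous_comp;
  [exact: tv_fun_continuous | exact: tv_fun_continuous].
Qed.

Lemma tv_comp_inv_continuous : continuous (tv_inv w \o tv_inv v).
Proof.
by move=> x; apply: continuous_comp;
  [exact: tv_inv_continuous | exact: tv_inv_continuous].
Qed.

Lemma tv_comp_sdp : sdp_map (v \o w).
Proof.
have [N HN] := adapted_comp (tv_sdp_map v) (tv_sdp_map w).
apply: (level_sdp_map (N := N) compK compVK) => m /HN[m' [m'' [wm vm]]].
by exists m'' => x /=; rewrite wm vm.
Qed.

Definition tv_comp : thompsonV :=
  ThompsonV compK compVK tv_comp_continuous tv_comp_inv_continuous tv_comp_sdp.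
End Comp.

Lemma tv_compA : associative tv_comp.
Proof. by move=> u v w; apply: thompsonV_eq. Qed.
Lemma tv_comp1v : left_id tv_one tv_comp.
Proof. by move=> v; apply: thompsonV_eq. Qed.
Lemma tv_compv1 : right_id tv_one tv_comp.
Proof. by move=> v; apply: thompsonV_eq. Qed.
Lemma tv_compVv : left_inverse tv_one tv_sym tv_comp.
Proof. by move=> v; apply: thompsonV_eq => x /=; rewrite tv_funK. Qed.
Lemma tv_compvV : right_inverse tv_one tv_sym tv_comp.
Proof. by move=> v; apply: thompsonV_eq => x /=; rewrite tv_invK. Qed.

HB.instance Definition _ := isGroup.Build thompsonV
  tv_compA tv_comp1v tv_compv1 tv_compVv tv_compvV.

Lemma adapted_at (v : thompsonV) (x : cantor_space) :
  exists mm : seq bool * seq bool, sdi mm.1 x /\ adapted v mm.1 mm.2.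
Proof.
have [N HN] := sdp_map_level (tv_sdp_map v).
have [|m' Hm] := HN (mkseq x N); first by rewrite size_mkseq.
by exists (mkseq x N, m'); split=> //; exact: sdi_mkseq.
Qed.

End ThompsonGroup.

Section LoopGroup.
Variable G : groupType.

Definition loc_const (a : cantor_space -> G) : Prop :=
  exists n (I : 'I_n -> seq bool), is_sdp I /\
    forall k x y, sdi (I k) x -> sdi (I k) y -> a x = a y.

Record loop_group := LoopGroup {
  loop_fun :> cantor_space -> G;
  loop_loc_const : loc_const loop_fun
}.

Lemma loop_group_eq (a b : loop_group) : (forall x, a x = b x) -> a = b.
Proof.
case: a b => [a ha] [b hb] /= /funext ab; subst b.
congr LoopGroup; exact: Prop_irrelevance.
Qed.

HB.instance Definition _ := gen_eqMixin loop_group.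
HB.instance Definition _ := gen_choiceMixin loop_group.

Lemma loc_constP a : loc_const a <->
  exists N, forall m, (N <= size m)%N ->
    forall x y, a (prepend m x) = a (prepend m y).
Proof.
split=> [[n [I [sI aI]]]|[N HN]].
  have [N HN] := is_sdp_bound sI; exists N => m /HN[k [r ->]] x y.
  by rewrite !prepend_cat; apply: (aI k); [exists (prepend r x)|exists (prepend r y)].
exists #|{: N.-tuple bool}|, (fun k => tval (enum_val k)); split.
  exact: is_sdp_level.
by move=> k _ _ [x _ <-] [y _ <-]; apply: HN; rewrite size_tuple.
Qed.

Lemma loop_one_loc_const : loc_const (fun=> 1).
Proof. by apply/loc_constP; exists 0. Qed.
Definition loop_one : loop_group := LoopGroup loop_one_loc_const.

Lemma loop_inv_loc_const (a : loop_group) : loc_const (fun x => (a x)^-1).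
Proof.
have /loc_constP[N HN] := loop_loc_const a; apply/loc_constP; exists N.
by move=> m /HN e x y; congr _^-1.
Qed.
Definition loop_inv (a : loop_group) : loop_group :=
  LoopGroup (loop_inv_loc_const a).

Lemma loop_mul_loc_const (a b : loop_group) : loc_const (fun x => a x * b x).
Proof.
have /loc_constP[N HN] := loop_loc_const a.
have /loc_constP[M HM] := loop_loc_const b.
apply/loc_constP; exists (maxn N M) => m; rewrite geq_max.
by case/andP=> /HN ea /HM eb x y; congr (_ * _).
Qed.
Definition loop_mul (a b : loop_group) : loop_group :=
  LoopGroup (loop_mul_loc_const a b).

Lemma loop_mulA : associative loop_mul.
Proof. by move=> a b c; apply: loop_group_eq => x /=; rewrite mulgA. Qed.
Lemma loop_mul1a : left_id loop_one loop_mul.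
Proof. by move=> a; apply: loop_group_eq => x /=; rewrite mul1g. Qed.
Lemma loop_mula1 : right_id loop_one loop_mul.
Proof. by move=> a; apply: loop_group_eq => x /=; rewrite mulg1. Qed.
Lemma loop_mulVa : left_inverse loop_one loop_inv loop_mul.
Proof. by move=> a; apply: loop_group_eq => x /=; rewrite mulVg. Qed.
Lemma loop_mulaV : right_inverse loop_one loop_inv loop_mul.
Proof. by move=> a; apply: loop_group_eq => x /=; rewrite mulgV. Qed.

HB.instance Definition _ := isGroup.Build loop_group
  loop_mulA loop_mul1a loop_mula1 loop_mulVa loop_mulaV.

End LoopGroup.

Section JonesAction.
Variables (G : groupType) (alpha0 alpha1 : automorphism G).

(* Products of automorphisms are compositions: the last letter of the word acts
   last. *)
Definition alpha_word (m : seq bool) : automorphism G :=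
  foldl (fun f l => (if l then alpha1 else alpha0) * f) 1 m.

Lemma alpha_word_cat m p : alpha_word (m ++ p) = alpha_word p * alpha_word m.
Proof.
rewrite /alpha_word foldl_cat; move: (foldl _ 1 m) => f.
elim/last_ind: p => [|p l IH]; first by rewrite mul1g.
by rewrite -!cats1 !foldl_cat /= IH mulgA.
Qed.

(* The interval is chosen arbitrarily; [tauE] shows the choice is immaterial. *)
Definition tau (v : thompsonV) (x : cantor_space) : automorphism G :=
  let mm := sval (cid (adapted_at v x)) in
  (alpha_word mm.2)^-1 * alpha_word mm.1.

Lemma tauE (v : thompsonV) x m m' : sdi m x -> adapted v m m' ->
  tau v x = (alpha_word m')^-1 * alpha_word m.
Proof.
rewrite /tau; case: cid => -[p p'] /= [].
wlog le : m m' p p' / (size m <= size p)%N => [hw|] px vp mx vm.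
  case/orP: (leq_total (size m) (size p)) => ?; first exact: hw.
  by symmetry; apply: hw.
case: mx px => [y _ ey] [z _ ez].
have [r [ep _]] := prepend_eq (etrans ey (esym ez)) le.
have ep' : p' = m' ++ r.
  by apply: prepend_word_inj => t; rewrite -vp ep !prepend_cat vm.
by rewrite ep ep' !alpha_word_cat invgM -!mulgA mulKg.
Qed.

Lemma tau_mul (v w : thompsonV) x : tau (v * w) x = tau v (w x) * tau w x.
Proof.
have [N HN] := adapted_comp (tv_sdp_map v) (tv_sdp_map w).
have [|m' [m'' [wm vm]]] := HN (mkseq x N); first by rewrite size_mkseq.
have mx := sdi_mkseq N x.
have mwx : sdi m' (w x) by case: mx => y _ <-; rewrite wm; exists y.
have vwm : adapted (v * w) (mkseq x N) m'' by move=> y /=; rewrite wm vm.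
by rewrite (tauE mx vwm) (tauE mx wm) (tauE mwx vm) -!mulgA mulVKg.
Qed.

Lemma tau1 x : tau 1 x = 1.
Proof.
by rewrite (@tauE _ _ [::] [::]) ?mulVg //; exists x => //; rewrite prepend_nil.
Qed.

(* This is pi_v(a)(vx) = tau_{v,x}(a(x)) with x = v^-1 y, see [jones_mapE]. *)
Definition jones_fun (v : thompsonV) (a : loop_group G) (y : cantor_space) : G :=
  tau v (v^-1 y) (a (v^-1 y)).

Lemma jones_loc_const v a : loc_const (jones_fun v a).
Proof.
have /sdp_map_level[N HN] := tv_sdp_map v^-1.
have /loc_constP[M HM] := loop_loc_const a.
apply/loc_constP; exists (N + M)%N => m le x y.
have Nm : (N <= size m)%N by apply: leq_trans le; exact: leq_addr.
have [|p Hp] := HN (take N m); first by rewrite size_takel.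
have vp : adapted v (p ++ drop N m) m.
  move=> z; rewrite prepend_cat -Hp -prepend_cat cat_take_drop.
  exact: (tv_invK v).
have vm z : v^-1 (prepend m z) = prepend (p ++ drop N m) z.
  by rewrite -(vp z); exact: (tv_funK v).
rewrite /jones_fun !vm.
rewrite (tauE (m := p ++ drop N m) _ vp); last by exists x.
rewrite (tauE (m := p ++ drop N m) _ vp); last by exists y.
congr (aut_fun _ _); apply: HM.
by rewrite size_cat size_drop; apply: leq_trans (leq_addl _ _); rewrite leq_subRL.
Qed.

Definition jones_map v a : loop_group G := LoopGroup (jones_loc_const v a).

Lemma jones_mapE v a x : jones_map v a (v x) = tau v x (a x).
Proof. by rewrite /= /jones_fun [v^-1 _](tv_funK v). Qed.

Lemma jones_mapM v w a : jones_map (v * w) a = jones_map v (jones_map w a).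
Proof.
apply: loop_group_eq => y; rewrite -[y](tv_invK (v * w)).
rewrite jones_mapE tau_mul aut_mulE -jones_mapE.
by rewrite -[jones_map w a _]/(jones_map w a _) -jones_mapE.
Qed.

Lemma jones_map1 a : jones_map 1 a = a.
Proof.
by apply: loop_group_eq => y; rewrite -[y]/((1 : thompsonV) y) jones_mapE tau1.
Qed.

Lemma jones_map_mul v : {morph jones_map v : a b / a * b}.
Proof. by move=> a b; apply: loop_group_eq => y /=; exact: aut_mul. Qed.

Lemma jones_mapK v : cancel (jones_map v) (jones_map v^-1).
Proof. by move=> a; rewrite -jones_mapM mulVg jones_map1. Qed.

Lemma jones_mapVK v : cancel (jones_map v^-1) (jones_map v).
Proof. by move=> a; rewrite -jones_mapM mulgV jones_map1. Qed.

Definition jones_action (v : thompsonV) : automorphism (loop_group G) :=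
  Automorphism (jones_map_mul v) (@jones_mapK v) (@jones_mapVK v).

Lemma jones_action_mul : {morph jones_action : v w / v * w}.
Proof. by move=> v w; apply: automorphism_eq => a; exact: jones_mapM. Qed.

HB.instance Definition _ :=
  isMultiplicative.Build thompsonV (automorphism (loop_group G))
    jones_action jones_action_mul.

Definition fraction_group : groupType := semidirect jones_action.

End JonesAction.

(* Main.v *)
Require Import Defs.
From HB Require Import structures.
From mathcomp Require Import all_boot.
From mathcomp Require Import boolp classical_sets functions filter.
From mathcomp Require Import topology cantor.

(* An isomorphism theta of fraction groups maps loops to loops: L = L_0 x L_1,
   where L_0 and L_1 are conjugate and commute, and commuting normal subgroups of
   a normal subgroup of V have disjoint supports. So theta induces an
   automorphism phi of V and an isomorphism kappa of the loop groups.

   As in Rubin's theorem, disjointness of supports is expressible in the group V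
   (here for elements of order 5), and a compactness argument gives for each
   point x a point y such that phi maps the elements that are trivial near x onto
   those that are trivial near y.

   Then kappa need not be local: loops vanishing at x may have a nontrivial image
   at y.  But by invariance and commutation this defect is central and extends
   to a V-invariant homomorphism zeta, so kappa(a)(y) = kappa_x(a(x)) zeta(a) with
   kappa_x a homomorphism.  As zeta vanishes on commutators [c, v], the
   homomorphism kappa_x is invertible, with inverse coming from theta^-1.

   If v fixes x, then phi(v) fixes y and kappa_x conjugates tau_{v,x} to
   tau_{phi(v),y}, up to inner automorphisms; take x constant and tau = alpha_i.
   Conversely, if f : G -> H conjugates alpha_i to a product of the i-th
   automorphism of H with an inner one, these inner automorphisms define a
   V-cocycle in the loop group of H that turns f into an isomorphism. *)

Set Implicit Arguments.
Unset Strict Implicit.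
Unset Printing Implicit Defensive.

Local Open Scope classical_set_scope.
Local Open Scope group_scope.

(** * The topology of the Cantor space *)

Lemma sdi_mkseqP (x z : cantor_space) N :
  sdi (mkseq x N) z <-> forall i, (i < N)%N -> z i = x i.
Proof.
split=> [[y _ <-] i iN|zx].
  by rewrite /prepend (set_nth_default false) ?size_mkseq // nth_mkseq.
suff -> : mkseq x N = mkseq z N by exact: sdi_mkseq.
by apply/eq_in_map => i; rewrite mem_iota => /zx ->.
Qed.

Lemma sdi_prepend (m : seq bool) z : sdi m (prepend m z).
Proof. by exists z. Qed.

Lemma sdi_mkseqE (m : seq bool) x : sdi m x -> m = mkseq x (size m).
Proof. by case=> y _ <-; rewrite mkseq_prepend. Qed.

Lemma sdi_cat (m p : seq bool) x : sdi (m ++ p) x -> sdi m x.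
Proof. by case=> y _ <-; rewrite prepend_cat; exact: sdi_prepend. Qed.

Lemma nbhs_cyl (x : cantor_space) N :
  nbhs x [set z | forall i, (i < N)%N -> z i = x i].
Proof.
elim: N => [|N IH]; first by apply: filterS filterT => z _ i.
have px : nbhs x [set z : cantor_space | z N = x N].
  have := @proj_continuous nat (fun=> bool) N x [set x N].
  by apply; exact: discrete_set1.
apply: filterS (filterI IH px) => z [zx zN] i.
by rewrite ltnS leq_eqVlt => /predU1P[->|/zx].
Qed.

Lemma nbhs_cantorP (x : cantor_space) (A : set cantor_space) :
  nbhs x A -> exists N, forall z, (forall i, (i < N)%N -> z i = x i) -> A z.
Proof.
pose F : set_system cantor_space :=
  [set B | exists N, forall z, (forall i, (i < N)%N -> z i = x i) -> B z].
have FF : Filter F.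
  split; first by exists 0.
  - move=> P Q [N HN] [M HM]; exists (maxn N M) => z zx.
    by split; [apply: HN|apply: HM] => i iN; apply: zx; rewrite leq_max iN ?orbT.
  - by move=> P Q PQ [N HN]; exists N => z /HN /PQ.
suff : F --> x by apply.
(* The product topology is the supremum of the topologies induced by the coordinates, so one
   coordinate [i] can be treated at a time; [i.+1] letters determine it. *)
apply/cvg_sup => i B; rewrite nbhsE /=; case=> C [[D _ <-] Dx] CB.
by exists i.+1 => z zx; apply: CB => /=; rewrite /= zx.
Qed.

(** * Elements of V *)

Definition agree n (x z : cantor_space) := forall i, (i < n)%N -> z i = x i.

Lemma agree_le n k x z : (k <= n)%N -> agree n x z -> agree k x z.
Proof. by move=> kn xz i ik; apply: xz; exact: leq_trans kn. Qed.

Lemma neq_cantor (x y : cantor_space) : x <> y -> exists i, x i <> y i.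
Proof. by move=> xy; apply/existsNP => e; apply/xy/funext. Qed.

Lemma not_sdi_agree (m : seq bool) x n z :
  ~ sdi m x -> (size m <= n)%N -> agree n x z -> ~ sdi m z.
Proof.
move=> mx mn xz mz; apply: mx; rewrite (sdi_mkseqE mz); apply/sdi_mkseqP => i im.
by rewrite xz //; exact: leq_trans mn.
Qed.

Lemma tv_mulE (v w : thompsonV) x : (v * w) x = v (w x).
Proof. by []. Qed.
Lemma tvK (v : thompsonV) x : v^-1 (v x) = x.
Proof. exact: tv_funK. Qed.
Lemma tvVK (v : thompsonV) x : v (v^-1 x) = x.
Proof. exact: tv_invK. Qed.
Lemma tv_inj (v : thompsonV) : injective v.
Proof. exact: can_inj (tvK v). Qed.

Lemma tv_coord (v : thompsonV) y i :
  exists N, forall z, agree N y z -> v z i = v y i.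
Proof.
have := @tv_fun_continuous v y _ (nbhs_cyl (v y) i.+1).
by move=> /nbhs_cantorP[N HN]; exists N => z /HN /(_ i); apply.
Qed.

(** Some coordinate separates [v y] from [y], and that coordinate of [v] is locally constant. As [z]
    and [z'] are independent, a small cylinder at [y] is disjoint from its image. *)
Lemma tv_moved (v : thompsonV) y : v y <> y ->
  exists N, forall n z z', (N <= n)%N -> agree n y z -> agree n y z' -> v z <> z'.
Proof.
move=> /neq_cantor[i vyi]; have [N HN] := tv_coord v y i.
exists (maxn N i.+1) => n z z'; rewrite geq_max => /andP[Nn iN] yz yz' e.
apply: vyi; rewrite -(HN z); last exact: agree_le yz.
by rewrite e yz'.
Qed.

Lemma tv_adapted_near (v : thompsonV) y :
  exists N, forall n, (N <= n)%N -> exists m, adapted v (mkseq y n) m.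
Proof.
have [N HN] := sdp_map_level (tv_sdp_map v).
by exists N => n Nn; apply: HN; rewrite size_mkseq.
Qed.

Lemma prepend_agree m n x z : agree n x z ->
  agree (size m + n) (prepend m x) (prepend m z).
Proof.
move=> xz i iN; rewrite /prepend; case: (ltnP i (size m)) => im.
  exact: set_nth_default.
by rewrite !nth_default // xz // ltn_subLR.
Qed.

Definition shiftc n (x : cantor_space) : cantor_space := fun i => x (n + i)%N.

Lemma prepend_shift m x : sdi m x -> prepend m (shiftc (size m) x) = x.
Proof. by move=> /sdi_mkseqE mx; rewrite {1}mx prepend_mkseq. Qed.

Lemma shift_prepend m x : shiftc (size m) (prepend m x) = x.
Proof. by apply: (@prepend_inj m); rewrite prepend_shift //; exists x. Qed.

Lemma level_continuous (v : cantor_space -> cantor_space) N :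
  (forall m, size m = N -> exists m', adapted v m m') -> continuous v.
Proof.
move=> ad x A /nbhs_cantorP[M HM].
apply: filterS (nbhs_cyl x (N + M)) => z zx; apply: HM => i iM.
have [|m' Hm] := ad (mkseq x N); first by rewrite size_mkseq.
have mz : sdi (mkseq x N) z.
  by apply/sdi_mkseqP => j jN; rewrite zx // ltn_addr.
rewrite -(prepend_shift mz) Hm -[v x](congr1 v (prepend_shift (sdi_mkseq N x))) Hm.
apply: (@prepend_agree m' M) => [j jM|]; last by rewrite ltn_addl.
by rewrite /shiftc size_mkseq zx // ltn_add2l.
Qed.

Definition incomp (m p : seq bool) := ~~ prefix m p && ~~ prefix p m.

Lemma incompC m p : incomp m p = incomp p m.
Proof. by rewrite /incomp andbC. Qed.

Lemma sdi_prefix m p x : sdi m x -> sdi p x -> (size m <= size p)%N -> prefix m p.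
Proof.
move=> [y _ ey] [z _ ez] /(prepend_eq (etrans ey (esym ez)))[r [-> _]].
exact: prefix_prefix.
Qed.

Lemma incompP m p x : incomp m p -> sdi m x -> ~ sdi p x.
Proof.
move=> /andP[mp pm] mx px; case/orP: (leq_total (size m) (size p)) => le.
  by apply: (negP mp); apply: sdi_prefix le; eassumption.
by apply: (negP pm); apply: sdi_prefix le; eassumption.
Qed.

Lemma disj_incomp m p : (forall x, sdi m x -> ~ sdi p x) -> incomp m p.
Proof.
move=> mp; apply/andP; split; apply/negP => /prefixP[r e].
  apply: (mp (prepend p point)); last exact: sdi_prepend.
  by rewrite e prepend_cat; exact: sdi_prepend.
apply: (mp (prepend m point)); first exact: sdi_prepend.
by rewrite e prepend_cat; exact: sdi_prepend.
Qed.

Lemma incomp_cat u m p : incomp (u ++ m) (u ++ p) = incomp m p.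
Proof. by rewrite /incomp !prefix_catr // !eqxx. Qed.

(** * Exchange of two disjoint dyadic intervals *)

Section Swap.
Variables m p : seq bool.

(** The identity when the two intervals meet, so that every pair of words yields an element of V. *)
Definition swap_fun (x : cantor_space) : cantor_space :=
  if ~~ incomp m p then x
  else if `[< sdi m x >] then prepend p (shiftc (size m) x)
  else if `[< sdi p x >] then prepend m (shiftc (size p) x)
  else x.

Let funL z : incomp m p -> swap_fun (prepend m z) = prepend p z.
Proof.
by move=> mp; rewrite /swap_fun mp /= asboolT ?shift_prepend //; exact: sdi_prepend.
Qed.

Let funR z : incomp m p -> swap_fun (prepend p z) = prepend m z.
Proof.
move=> mp; rewrite /swap_fun mp /= asboolF; last first.
  by move=> h; apply: incompP mp h _; exact: sdi_prepend.
by rewrite asboolT ?shift_prepend //; exact: sdi_prepend.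
Qed.

Let fun_out x : ~ sdi m x -> ~ sdi p x -> swap_fun x = x.
Proof. by move=> mx px; rewrite /swap_fun; case: ifP => // _; rewrite !asboolF. Qed.

Lemma swap_funK : involutive swap_fun.
Proof.
move=> x; case mp: (incomp m p); last by rewrite /swap_fun mp.
case: (pselect (sdi m x)) => [[z _ <-]|mx]; first by rewrite funL // funR.
case: (pselect (sdi p x)) => [[z _ <-]|px]; first by rewrite funR // funL.
by rewrite !fun_out // !fun_out.
Qed.

Lemma swap_fun_level q : size q = maxn (size m) (size p) ->
  exists q', adapted swap_fun q q'.
Proof.
move=> sq; case mp: (incomp m p); last first.
  by exists q => x; rewrite /swap_fun mp.
case: (boolP (prefix m q)) => [/prefixP[r ->]|mq].
  by exists (p ++ r) => x; rewrite !prepend_cat funL.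
case: (boolP (prefix p q)) => [/prefixP[r ->]|pq].
  by exists (m ++ r) => x; rewrite !prepend_cat funR.
exists q => x; apply: fun_out => h.
  apply: (negP mq); apply: sdi_prefix h (sdi_prepend q x) _.
  by rewrite sq leq_maxl.
apply: (negP pq); apply: sdi_prefix h (sdi_prepend q x) _.
by rewrite sq leq_maxr.
Qed.

Definition swap : thompsonV :=
  ThompsonV swap_funK swap_funK
    (level_continuous swap_fun_level) (level_continuous swap_fun_level)
    (level_sdp_map swap_funK swap_funK swap_fun_level).

Lemma swapL z : incomp m p -> swap (prepend m z) = prepend p z.
Proof. exact: funL. Qed.
Lemma swapR z : incomp m p -> swap (prepend p z) = prepend m z.
Proof. exact: funR. Qed.
Lemma swap_out x : ~ sdi m x -> ~ sdi p x -> swap x = x.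
Proof. exact: fun_out. Qed.
Lemma swap_swap : swap * swap = 1.
Proof. by apply: thompsonV_eq; exact: swap_funK. Qed.
Lemma swapV : swap^-1 = swap.
Proof. by apply: mulg1_eq; exact: swap_swap. Qed.
End Swap.

(** Triviality of the germ of [v] at [x]. *)
Definition id_near (v : thompsonV) (x : cantor_space) :=
  exists N, forall z, agree N x z -> v z = z.

Lemma id_near_fix v x : id_near v x -> v x = x.
Proof. by case=> N; apply. Qed.

Lemma swap_id_near m p x : ~ sdi m x -> ~ sdi p x -> id_near (swap m p) x.
Proof.
move=> mx px; exists (maxn (size m) (size p)) => z xz; apply: swap_out.
  by apply: not_sdi_agree mx _ xz; exact: leq_maxl.
by apply: not_sdi_agree px _ xz; exact: leq_maxr.
Qed.

Lemma id_near_mul v w x : id_near v x -> id_near w x -> id_near (v * w) x.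
Proof.
move=> [N HN] [M HM]; exists (maxn N M) => z xz; rewrite tv_mulE HM; last first.
  by apply: agree_le xz; exact: leq_maxr.
by apply: HN; apply: agree_le xz; exact: leq_maxl.
Qed.

(** The interval of the sequences that leave [x] exactly at coordinate [n]: it misses [x] but can be
    taken as close to [x] as desired. *)
Definition branch (x : cantor_space) n := rcons (mkseq x n) (~~ x n).

Lemma branch_out x n : ~ sdi (branch x n) x.
Proof.
move=> /sdi_mkseqE; rewrite /branch size_rcons size_mkseq mkseqS.
by move=> /rcons_inj[]; case: (x n).
Qed.

Lemma branch_agree x n z : sdi (branch x n) z -> agree n x z.
Proof.
by rewrite /branch -cats1 => /sdi_cat /sdi_mkseqP.
Qed.

Lemma branch_incomp m x n : ~ sdi m x -> (size m <= n)%N -> incomp m (branch x n).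
Proof.
move=> mx mn; apply: disj_incomp => z mz /branch_agree xz.
exact: not_sdi_agree mx mn xz mz.
Qed.

(* Both intervals are swapped in turn with a third one close to [x]. *)
Lemma tv_transitive m p x : ~ sdi m x -> ~ sdi p x ->
  exists v : thompsonV, id_near v x /\ adapted v m p.
Proof.
move=> mx px; set r := branch x (maxn (size m) (size p)).
have mr : incomp m r by apply: branch_incomp => //; exact: leq_maxl.
have pr : incomp p r by apply: branch_incomp => //; exact: leq_maxr.
exists (swap p r * swap m r); split; last by move=> z; rewrite tv_mulE swapL // swapR.
by apply: id_near_mul; apply: swap_id_near => //; exact: branch_out.
Qed.

(** * Commuting elements of V *)

Definition comm (T : groupType) (g h : T) := g * h * g^-1 * h^-1.

Definition disj (f g : thompsonV) := forall x, f x = x \/ g x = x.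

Lemma disjC f g : disj f g -> disj g f.
Proof. by move=> fg x; case: (fg x); [right|left]. Qed.

Lemma disj_commute f g : disj f g -> f * g = g * f.
Proof.
have half (u v : thompsonV) : disj u v -> forall x, u x = x -> u (v x) = v (u x).
  move=> uv x ux; rewrite ux; case: (uv (v x)) => // vvx.
  by rewrite (tv_inj vvx) ux.
move=> fg; apply: thompsonV_eq => x; rewrite !tv_mulE.
by case: (fg x) => [/(half _ _ fg)//|/(half _ _ (disjC fg))].
Qed.

Lemma not_disj f g : ~ disj f g -> exists x, f x <> x /\ g x <> x.
Proof. by move=> /existsNP[x /not_orP]; exists x. Qed.

(** The rigid stabiliser of the interval of word [u]. *)
Definition rist (u : seq bool) (v : thompsonV) := forall x, ~ sdi u x -> v x = x.

Lemma rist_mul u v w : rist u v -> rist u w -> rist u (v * w).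
Proof. by move=> uv uw x ux; rewrite tv_mulE uw // uv. Qed.

Lemma rist_inv u v : rist u v -> rist u v^-1.
Proof. by move=> uv x ux; rewrite -{1}(uv x ux) tvK. Qed.

Lemma rist_comm u v w : rist u v -> rist u w -> rist u (comm v w).
Proof. by move=> *; do ![apply: rist_mul => //|apply: rist_inv => //]. Qed.

Lemma rist_swap u m p : rist u (swap (u ++ m) (u ++ p)).
Proof. by move=> x ux; apply: swap_out => /sdi_cat. Qed.

Definition moves_off (p : thompsonV) u := forall z, sdi u z -> ~ sdi u (p z).

Lemma moved_off (p : thompsonV) y : p y <> y ->
  exists N, forall n, (N <= n)%N -> moves_off p (mkseq y n).
Proof.
move=> /tv_moved[N HN]; exists N => n Nn z /sdi_mkseqP yz /sdi_mkseqP yz'.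
exact: HN Nn yz yz' erefl.
Qed.

Lemma commVg (T : groupType) (a h k : T) : a * h = h * a -> a * k = k * a ->
  comm (a * h^-1) k = comm h^-1 k.
Proof.
move=> ah ak; rewrite /comm invgM invgK.
have ah' : a * h^-1 = h^-1 * a by apply: commuteV.
have ha' : h * a^-1 = a^-1 * h by apply: commuteV.
by rewrite ah' ha' -!mulgA; congr (_ * _); rewrite mulgA ak -!mulgA; congr (_ * _);
  rewrite mulgA mulgV mul1g.
Qed.

(** [comm p h] is the product of [p * h * p^-1] and [h^-1]. The first factor is supported in the
    image of the interval under [p], away from the interval itself, so it commutes with [h] and [k]
    and drops out of the outer commutator. *)
Lemma comm_moves_off p u h k : moves_off p u -> rist u h -> rist u k ->
  comm (comm p h) k = comm h^-1 k.
Proof.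
move=> pu uh uk; rewrite {2}/comm; apply: commVg; apply: disj_commute => x.
  case: (pselect (sdi u x)) => [ux|/uh]; [left|by right].
  rewrite !tv_mulE uh ?tvVK // => /pu; by rewrite tvVK.
case: (pselect (sdi u x)) => [ux|/uk]; [left|by right].
rewrite !tv_mulE uh ?tvVK // => /pu; by rewrite tvVK.
Qed.

Lemma swap_outw m p q z : incomp m q -> incomp p q ->
  swap m p (prepend q z) = prepend q z.
Proof.
by move=> mq pq; apply: swap_out => h; [apply: incompP mq h _|apply: incompP pq h _];
  exact: sdi_prepend.
Qed.

Lemma swap_word m p z : incomp m p ->
  (swap m p (prepend m z) = prepend p z) * (swap m p (prepend p z) = prepend m z).
Proof. by move=> mp; rewrite swapL // swapR. Qed.

(* Two adjacent commutators of the transpositions of four disjoint intervals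
   are 3-cycles, which do not commute. *)
Lemma three_cycles_noncommuting a b c d :
  incomp a b -> incomp a c -> incomp a d -> incomp b c -> incomp b d -> incomp c d ->
  comm (comm (swap a b) (swap b c)) (comm (swap b c) (swap c d)) <> 1.
Proof.
move=> ab ac ad bc bd cd; set H := comm (swap a b) _; set K := comm _ (swap c d).
move/divg1_eq/eqP; rewrite divg_eq => /eqP HK.
have [ca da cb db dc] : [/\ incomp c a, incomp d a, incomp c b, incomp d b & incomp d c].
  by rewrite !(incompC c) !(incompC d).
have Ka z : K (prepend a z) = prepend a z.
  by rewrite /K /comm !swapV !tv_mulE !swap_outw // incompC.
have Kc z : K (prepend c z) = prepend b z.
  rewrite /K /comm !swapV !tv_mulE.
  rewrite (swap_word _ cd) swap_outw // (swap_word _ cd).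
  by rewrite (swap_word _ bc).
have Ha z : H (prepend a z) = prepend c z.
  rewrite /H /comm !swapV !tv_mulE.
  rewrite [swap b c (prepend a z)]swap_outw 1?incompC // (swap_word _ ab).
  by rewrite (swap_word _ bc) swap_outw // incompC.
have : (H * K) (prepend a point) = (K * H) (prepend a point) by rewrite HK.
rewrite (tv_mulE H K) (tv_mulE K H) Ka Ha Kc => e.
by apply: (incompP bc (sdi_prepend b point)); rewrite -e; exact: sdi_prepend.
Qed.

(* The elements supported in [u] do not form a metabelian group, since they contain
   the symmetric group on the four pieces of depth two of [u]. *)
Lemma rist_not_metabelian u (W : thompsonV -> Prop) :
  (forall h k, rist u h -> rist u k -> W (comm h k)) ->
  (forall h k, rist u h -> rist u k -> W h -> W k -> comm h k = 1) -> False.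
Proof.
move=> W1 W2.
apply: (@three_cycles_noncommuting (u ++ [:: false; false]) (u ++ [:: false; true])
          (u ++ [:: true; false]) (u ++ [:: true; true])); rewrite ?incomp_cat //.
by apply: W2; [| |apply: W1|apply: W1]; do ?apply: rist_comm; exact: rist_swap.
Qed.

Lemma rist_noncommuting u : exists h k, [/\ rist u h, rist u k & comm h k <> 1].
Proof.
apply: contrapT => H; apply: (@rist_not_metabelian u (fun h => h = 1)) => h k uh uk.
  by apply: contrapT => hk; apply: H; exists h, k.
by move=> -> _; rewrite /comm invg1 mulg1 mul1g mulgV.
Qed.

Lemma tv_exp5 (g : thompsonV) x : (g ^+ 5) x = g (g (g (g (g x)))).
Proof. by []. Qed.

(** * Five-cycles of dyadic intervals *)

Section FiveCycle.
Variable u : seq bool.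
Let w1 := u ++ [:: false; false; false].
Let w2 := u ++ [:: false; false; true].
Let w3 := u ++ [:: false; true].
Let w4 := u ++ [:: true; false].
Let w5 := u ++ [:: true; true].

(** The five words partition the interval of [u], and the product of transpositions permutes them
    cyclically. Five is prime, so the nontrivial powers move the same points, and it exceeds the
    four translates counted in [algdisj_disj]. *)
Definition cyc : thompsonV := swap w1 w2 * swap w2 w3 * swap w3 w4 * swap w4 w5.

Let inc : [/\ incomp w1 w2, incomp w2 w3, incomp w3 w4, incomp w4 w5 &
  [/\ incomp w2 w4, incomp w2 w5, incomp w3 w5, incomp w3 w1 &
  [/\ incomp w4 w1, incomp w5 w1 & incomp w4 w2]]].
Proof. by split; [..|split; [..|split]]; rewrite incomp_cat. Qed.

Let cyc1 z : cyc (prepend w1 z) = prepend w2 z.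
Proof.
case: inc => i12 i23 i34 i45 [i24 i25 i35 i31 [i41 i51 i42]].
rewrite /cyc !tv_mulE [swap w4 w5 _]swap_outw // [swap w3 w4 _]swap_outw //.
by rewrite [swap w2 w3 _]swap_outw 1?incompC // 1?incompC // swapL // incompC.
Qed.

Let cyc2 z : cyc (prepend w2 z) = prepend w3 z.
Proof.
case: inc => i12 i23 i34 i45 [i24 i25 i35 i31 [i41 i51 i42]].
rewrite /cyc !tv_mulE [swap w4 w5 _]swap_outw 1?[incomp w5 _]incompC //.
rewrite [swap w3 w4 _]swap_outw 1?[incomp w3 _]incompC // swapL //.
by rewrite swap_outw 1?[incomp w1 _]incompC.
Qed.

Let cyc3 z : cyc (prepend w3 z) = prepend w4 z.
Proof.
case: inc => i12 i23 i34 i45 [i24 i25 i35 i31 [i41 i51 i42]].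
rewrite /cyc !tv_mulE [swap w4 w5 _]swap_outw 1?[incomp _ w3]incompC // swapL //.
rewrite [swap w2 w3 _]swap_outw //.
by rewrite swap_outw 1?[incomp w1 _]incompC.
Qed.

Let cyc4 z : cyc (prepend w4 z) = prepend w5 z.
Proof.
case: inc => i12 i23 i34 i45 [i24 i25 i35 i31 [i41 i51 i42]].
rewrite /cyc !tv_mulE swapL //.
rewrite [swap w3 w4 _]swap_outw // [swap w2 w3 _]swap_outw //.
by rewrite swap_outw 1?[incomp w1 _]incompC.
Qed.

Let cyc5 z : cyc (prepend w5 z) = prepend w1 z.
Proof.
case: inc => i12 i23 i34 i45 [i24 i25 i35 i31 [i41 i51 i42]].
by rewrite /cyc !tv_mulE !swapR.
Qed.

Lemma cyc_rist : rist u cyc.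
Proof. by do ![apply: rist_mul|apply: rist_swap]. Qed.

Let cover x : sdi u x -> exists z, [\/ x = prepend w1 z, x = prepend w2 z,
  x = prepend w3 z | x = prepend w4 z] \/ x = prepend w5 z.
Proof.
case=> y _ <-; rewrite -(prepend_mkseq 3 y) /mkseq /=; set z : cantor_space := fun n => y (3 + n)%N.
rewrite /w1 /w2 /w3 /w4 /w5; case: (y 0%N); case: (y 1%N); case: (y 2%N).
- by exists (prepend [:: true] z); right; rewrite -!prepend_cat -?catA.
- by exists (prepend [:: false] z); right; rewrite -!prepend_cat -?catA.
- by exists (prepend [:: true] z); left; constructor 4; rewrite -!prepend_cat -?catA.
- by exists (prepend [:: false] z); left; constructor 4; rewrite -!prepend_cat -?catA.
- by exists (prepend [:: true] z); left; constructor 3; rewrite -!prepend_cat -?catA.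
- by exists (prepend [:: false] z); left; constructor 3; rewrite -!prepend_cat -?catA.
- by exists z; left; constructor 2; rewrite -!prepend_cat.
- by exists z; left; constructor 1; rewrite -!prepend_cat.
Qed.

Lemma cyc_order5 : cyc ^+ 5 = 1.
Proof.
apply: thompsonV_eq => x; rewrite tv_exp5.
case: (pselect (sdi u x)) => [/cover[z [[] -> | ->]]|/cyc_rist cx]; last by rewrite !cx.
all: by rewrite ?(cyc1, cyc2, cyc3, cyc4, cyc5).
Qed.

Lemma cyc_moves x : sdi u x -> cyc x <> x.
Proof.
case: inc => i12 i23 i34 i45 [i24 i25 i35 i31 [i41 i51 i42]].
have d p q z : incomp p q -> prepend q z <> prepend p z.
  by move=> pq e; apply: (incompP pq (sdi_prepend p z)); rewrite -e; exact: sdi_prepend.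
case/cover=> z [[] -> | ->]; rewrite ?(cyc1, cyc2, cyc3, cyc4, cyc5); exact: d.
Qed.
End FiveCycle.

(** Rubin's algebraic disjointness. It mentions only the group law, so isomorphisms preserve it. *)
Definition algdisj (f g : thompsonV) := forall h, h * f <> f * h ->
  exists f1 f2, [/\ f1 * g = g * f1, f2 * g = g * f2,
    comm (comm h f1) f2 * g = g * comm (comm h f1) f2 & comm (comm h f1) f2 <> 1].

(** If [h] does not commute with [f], some point is moved by both. A small interval [u] around it is
    moved off itself by [h] and lies in the support of [f], where [g] is trivial; hence all elements
    supported in [u] commute with [g]. *)
Lemma disj_algdisj f g : disj f g -> algdisj f g.
Proof.
move=> fg h hf; have : ~ disj h f by move=> /disj_commute.
move=> /not_disj[x [/moved_off[N HN] /tv_moved[M HM]]].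
pose u := mkseq x (maxn N M).
have hu : moves_off h u by apply: HN; exact: leq_maxl.
have ug k : rist u k -> k * g = g * k.
  move=> uk; apply: disj_commute => z; case: (pselect (sdi u z)) => [uz|/uk]; last by left.
  right; case: (fg z) => // fz; case: (HM (maxn N M) z z); rewrite ?leq_maxr //;
    exact/sdi_mkseqP.
have [f1 [f2 [u1 u2 n12]]] := rist_noncommuting u.
(* The inverse cancels the one produced by [comm_moves_off], leaving the nontrivial [comm f1 f2]. *)
exists f1^-1, f2; rewrite (comm_moves_off hu) //; last exact: rist_inv.
rewrite invgK; split=> //; apply: ug => //; first exact: rist_inv.
exact: rist_comm.
Qed.

Lemma comm_moved (f g : thompsonV) (P : cantor_space -> Prop) z :
  (forall x, ~ P x -> f x = x) -> comm f g z <> z -> P z \/ P (g^-1 z).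
Proof.
move=> fP; apply: contra_notP => /not_orP[Pz Pgz].
rewrite /comm !tv_mulE; have -> : f^-1 (g^-1 z) = g^-1 z by rewrite -{1}(fP _ Pgz) tvK.
by rewrite tvVK fP.
Qed.

Lemma order5_pow (g : thompsonV) y i : g ^+ 5 = 1 -> g y <> y -> (0 < i < 5)%N ->
  (g ^+ i) y <> y.
Proof.
move=> g5 gy i5 gi; apply: gy.
have gk k : (g ^+ (i * k)) y = y.
  by elim: k => [|k IH]; rewrite ?muln0 // mulnS expgnDr tv_mulE IH.
have g1 k : g ^+ (k * 5).+1 = g by rewrite expgS mulnC expgnA g5 expg1n mulg1.
(* The inverses of 2, 3, 4 modulo 5 are 3, 2, 4: the products are 6, 6 and 16. *)
case: i i5 gi gk => [|[|[|[|[|//]]]]] // _ gi gk.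
- by have := gk 3%N; rewrite (g1 1%N).
- by have := gk 2%N; rewrite (g1 1%N).
- by have := gk 4%N; rewrite (g1 3%N).
Qed.

Lemma order5_moves_off (g : thompsonV) y : g ^+ 5 = 1 -> g y <> y ->
  exists N, forall n i, (N <= n)%N -> (0 < i < 5)%N -> moves_off (g ^+ i) (mkseq y n).
Proof.
move=> g5 gy; have H i : exists N, (0 < i < 5)%N ->
    forall n, (N <= n)%N -> moves_off (g ^+ i) (mkseq y n).
  case: (boolP (0 < i < 5)%N) => [i5|]; last by exists 0%N.
  by have [N HN] := moved_off (order5_pow g5 gy i5); exists N.
have [N HN] := choice H; exists (\max_(i < 5) N i)%N => n i Nn i5.
apply: HN => //; apply: leq_trans Nn.
by have /andP[_ i5'] := i5; exact: (leq_bigmax (Ordinal i5')).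
Qed.

(* [comm (comm h f1) f2] is supported in four translates of [u] by elements
   commuting with [g], and its support is [g]-invariant; each translate contains
   at most one of the five points [g ^+ i z]. *)
Lemma algdisj_disj f g : g ^+ 5 = 1 -> algdisj f g -> disj f g.
Proof.
move=> g5 fg; apply: contrapT => /not_disj[y [fy gy]].
have [N HN] := moved_off fy; have [M HM] := order5_moves_off g5 gy.
pose u := mkseq y (maxn N M).
have fu : moves_off f u by apply: HN; exact: leq_maxl.
have gu i : (0 < i < 5)%N -> moves_off (g ^+ i) u by apply: HM; exact: leq_maxr.
have [|f1 [f2 [f1g f2g]]] := fg (cyc u).
  move=> /(congr1 (fun v : thompsonV => v y)); rewrite (tv_mulE _ f) (tv_mulE f).
  rewrite (cyc_rist (fu _ (sdi_mkseq _ _))) => /tv_inj.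
  by apply/nesym/cyc_moves/sdi_mkseq.
set k := comm _ f2 => kg k1; have [z kz] : exists z, k z <> z.
  by apply/existsNP => h; apply/k1/thompsonV_eq.
pose w (j : 'I_4) : thompsonV := [tuple 1; f1^-1; f2^-1; f1^-1 * f2^-1]`_j.
have wg j : commute (w j) g.
  have c1 : commute f1^-1 g by apply/commute_sym/commuteV.
  have c2 : commute f2^-1 g by apply/commute_sym/commuteV.
  case: j => -[|[|[|[|//]]]] jl; rewrite /w //=; first exact/commute_sym/commute1.
  exact/commute_sym/commuteM; exact/commute_sym.
have kw x : k x <> x -> exists j, sdi u (w j x).
  have cP v : ~ (sdi u v \/ sdi u (f1^-1 v)) -> comm (cyc u) f1 v = v.
    by move=> h; apply: contrapT => /(comm_moved (@cyc_rist u)); exact: h.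
  case/(comm_moved cP) => [[]|[]] ux.
  - by exists (@Ordinal 4 0 isT).
  - by exists (@Ordinal 4 1 isT).
  - by exists (@Ordinal 4 2 isT).
  - by exists (@Ordinal 4 3 isT).
have kgi i : k ((g ^+ i) z) <> (g ^+ i) z.
  rewrite -tv_mulE (_ : k * g ^+ i = g ^+ i * k); last exact: commuteX.
  by rewrite tv_mulE => /tv_inj.
have [J HJ] := choice (fun i : 'I_5 => kw _ (kgi i)).
have Jinj : injective J.
  have lt i i' : J i = J i' -> ~ (i < i')%N.
    move=> eJ ii'; have /gu : (0 < i' - i < 5)%N.
      by rewrite subn_gt0 ii' (leq_ltn_trans (leq_subr _ _)).
    move=> /(_ _ (HJ i)); apply; rewrite -!tv_mulE.
    have -> : g ^+ (i' - i) * w (J i) * g ^+ i = w (J i') * g ^+ i'.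
      rewrite eJ -(commuteX (i' - i) (wg _)) -mulgA -expgnDr subnK //.
      exact: ltnW.
    exact: HJ.
  move=> i i' e; apply/val_inj; case: (ltngtP i i') => // [/lt|/lt]; by [case|case].
by have := leq_card J Jinj; rewrite !card_ord.
Qed.

(** * Reconstruction of the Cantor space from V *)

(** Near [x], [g] replaces a prefix [m] by some [m'], and both are prefixes of [x]. If one were a
    proper extension of the other, by [r], five iterations would add or remove [r] five times. So
    the support of [g] is closed as well as open. *)
Lemma order5_fix_id_near (g : thompsonV) x : g ^+ 5 = 1 -> g x = x -> id_near g x.
Proof.
move=> g5 gx; have [N HN] := tv_adapted_near g x; exists N => z /sdi_mkseqP xz.
have [m' gm] := HN N (leqnn N); set m := mkseq x N in xz gm.
have [y _ ey] := sdi_mkseq N x.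
have e : prepend m y = prepend m' y by rewrite -gm [prepend _ _]ey gx.
suff mm' : m = m' by case: xz => t _ <-; rewrite gm -mm'.
have g5E t : g (g (g (g (g t)))) = t by rewrite -tv_exp5 g5.
have nil r : (forall t, prepend (r ++ (r ++ (r ++ (r ++ r)))) t = t) -> r = [::].
  move=> rt; have : r ++ (r ++ (r ++ (r ++ r))) = [::].
    by apply: prepend_word_inj => t; rewrite rt prepend_nil.
  by case: r {rt}.
case/orP: (leq_total (size m) (size m')) => le.
  have [r [em' _]] := prepend_eq e le; rewrite em' (nil r) ?cats0 // => t.
  have gr s : g (prepend m s) = prepend m (prepend r s) by rewrite gm em' prepend_cat.
  by apply: (@prepend_inj m); rewrite !prepend_cat -!gr g5E.
have [r [em _]] := prepend_eq (esym e) le; rewrite em (nil r) ?cats0 // => t.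
have gr s : g (prepend m' (prepend r s)) = prepend m' s by rewrite -prepend_cat -em gm.
by apply: (@prepend_inj m'); rewrite -[LHS]g5E !prepend_cat !gr.
Qed.

(** Cantor's intersection theorem; the third hypothesis says that each [S n] is closed. *)
Lemma nested_nonempty (S : nat -> set cantor_space) :
  (forall n, S n !=set0) -> (forall n k, (n <= k)%N -> S k `<=` S n) ->
  (forall n z, ~ S n z -> exists N, forall t, agree N z t -> ~ S n t) ->
  exists y, forall n, S n y.
Proof.
move=> S0 Sle Sc; pose F : set_system cantor_space := [set A | exists n, S n `<=` A].
have FF : ProperFilter F.
  split; first by case=> n; have [z] := S0 n; move=> /[swap] /[apply].
  split; first by exists 0%N.
    move=> A B [n nA] [k kB]; exists (maxn n k) => z nkz.
    by split; [apply: nA|apply: kB]; apply: Sle nkz; rewrite ?leq_maxl ?leq_maxr.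
  by move=> A B AB [n nA]; exists n => z /nA /AB.
have [|y [_ Fy]] := cantor_space_compact FF; first by exists 0%N.
exists y => n; apply: contrapT => /Sc[N HN].
have [|z [Sz /HN]] := Fy (S n) _ _ (nbhs_cyl y N); first by exists n.
exact.
Qed.

Section Morphism.
Variables (G H : groupType) (phi : G -> H).
Hypothesis phiM : {morph phi : v w / v * w}.

Lemma morph1 : phi 1 = 1.
Proof. by apply: (mulgI (phi 1)); rewrite -phiM !mulg1. Qed.
Lemma morphV v : phi v^-1 = (phi v)^-1.
Proof. by apply: (mulgI (phi v)); rewrite -phiM !mulgV morph1. Qed.
Lemma morphX g n : phi (g ^+ n) = phi g ^+ n.
Proof. by elim: n => [|n IH]; rewrite ?expg0 ?morph1 // !expgS phiM IH. Qed.
Lemma morphR g h : phi (comm g h) = comm (phi g) (phi h).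
Proof. by rewrite /comm !phiM !morphV. Qed.
End Morphism.

(** The detour through [algdisj] works because [phi g] satisfies the fifth power condition too. *)
Lemma disj_morph (phi psi : thompsonV -> thompsonV) f g :
  {morph phi : v w / v * w} -> cancel phi psi -> cancel psi phi ->
  g ^+ 5 = 1 -> disj f g -> disj (phi f) (phi g).
Proof.
move=> phiM phiK psiK g5 /disj_algdisj fg.
apply: algdisj_disj; first by rewrite -morphX // g5 morph1.
move=> h hf; have [|f1 [f2 [f1g f2g kg k1]]] := fg (psi h).
  by move=> /(congr1 phi); rewrite !phiM psiK.
exists (phi f1), (phi f2); rewrite -(psiK h) -!morphR // -!phiM f1g f2g kg; split=> //.
by rewrite -(morph1 phiM) => /(can_inj phiK).
Qed.

(** The five-cycles [c n] have the cylinders around [x] as supports. The supports [S n] of their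
    images are nested and closed, and [y] is a common point. If [v] is trivial near [x] it is
    disjoint from some [c N], so [phi v] is disjoint from [phi (c N)], which moves all points near
    [y]. *)
Lemma id_near_morph (phi psi : thompsonV -> thompsonV) x :
  {morph phi : v w / v * w} -> cancel phi psi -> cancel psi phi ->
  exists y, forall v, id_near v x -> id_near (phi v) y.
Proof.
move=> phiM phiK psiK; have psiM : {morph psi : v w / v * w}.
  by move=> v w; apply: (can_inj phiK); rewrite phiM !psiK.
pose c n := cyc (mkseq x n); pose S n := [set y | phi (c n) y <> y].
have c5 n : c n ^+ 5 = 1 by exact: cyc_order5.
have pc5 n : phi (c n) ^+ 5 = 1 by rewrite -morphX // c5 morph1.
have agree_disj (v : thompsonV) t n :
    (forall z, agree n t z -> v z = z) -> disj (cyc (mkseq t n)) v.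
  move=> vx z; case: (pselect (sdi (mkseq t n) z)) => [/sdi_mkseqP/vx|/cyc_rist];
    by [left|right].
have [||n y Sny|y Sy] := @nested_nonempty S.
- move=> n; apply: contrapT => h; apply: (@cyc_moves (mkseq x n) x (sdi_mkseq _ _)).
  suff -> : cyc (mkseq x n) = 1 by [].
  apply: (can_inj phiK); rewrite morph1 //; apply: thompsonV_eq => y.
  by apply: contrapT => hy; apply: h; exists y.
(* Otherwise [phi (c n)] is trivial on a cylinder at [y]. The five-cycle of that cylinder pulls back
   to an element disjoint from [c n], hence from [c k]; so it is itself disjoint from [phi (c k)],
   yet both move [y]. *)
- move=> n k nk y Sky Sny; have [N /agree_disj tn] := order5_fix_id_near (pc5 n) Sny.
  have := disj_morph psiM psiK phiK (pc5 n) tn; rewrite phiK => {}tn.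
  have tk : disj (psi (cyc (mkseq y N))) (c k).
    move=> z; case: (tn z) => cz; [by left|right].
    apply: cyc_rist => /sdi_mkseqP xz; case: (@cyc_moves (mkseq x n) z) => //.
    by apply/sdi_mkseqP; exact: agree_le xz.
  have := disj_morph phiM phiK psiK (c5 k) tk; rewrite psiK => /(_ y)[].
    exact/cyc_moves/sdi_mkseq.
  exact: Sky.
- have [N HN] := order5_fix_id_near (pc5 n) (contrapT Sny).
  by exists N => t /HN e; apply.
exists y => v [N /agree_disj/disjC vN]; have [M HM] := tv_moved (Sy N).
exists M => z yz; have [] // := disj_morph phiM phiK psiK (c5 N) vN z.
by case/(HM M z z).
Qed.

Lemma id_near_unique y y' :
  (forall v, id_near v y -> id_near v y') -> y = y'.
Proof.
move=> yy'; apply: contrapT => /neq_cantor[i ne].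
pose u := mkseq y' i.+1.
have yu : ~ sdi u y by move=> /sdi_mkseqP /(_ i (ltnSn i)) e; apply: ne.
have : id_near (cyc u) y.
  exists i.+1 => z yz; apply: cyc_rist; apply: not_sdi_agree yu _ yz.
  by rewrite size_mkseq.
by move=> /yy'/id_near_fix; apply/cyc_moves/sdi_mkseq.
Qed.

(* Rubin's theorem for [V], in terms of stabilisers of germs. *)
Lemma id_near_iso (phi psi : thompsonV -> thompsonV) x :
  {morph phi : v w / v * w} -> cancel phi psi -> cancel psi phi ->
  exists y, forall v, id_near v x <-> id_near (phi v) y.
Proof.
move=> phiM phiK psiK; have psiM : {morph psi : v w / v * w}.
  by move=> v w; apply: (can_inj phiK); rewrite phiM !psiK.
have [y xy] := id_near_morph x phiM phiK psiK.
have [x' yx'] := id_near_morph y psiM psiK phiK.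
exists y => v; split=> [/xy//|/yx']; rewrite phiK.
suff -> : x = x' by [].
by apply: id_near_unique => w /xy/yx'; rewrite phiK.
Qed.

Lemma neq_agree (x y : cantor_space) : x <> y ->
  exists N, forall n, (N <= n)%N -> ~ agree n x y.
Proof.
move=> /neq_cantor[i xy]; exists i.+1 => n iN xy'; apply: xy.
by rewrite xy'.
Qed.

(** * Commuting subgroups of a normal subgroup of V *)

Section CommutingNormal.
Variables P Q M : thompsonV -> Prop.
Hypotheses (PM : forall p, P p -> M p) (QM : forall q, Q q -> M q).
Hypotheses (MM : forall m k, M m -> M k -> M (m * k)) (MV : forall m, M m -> M m^-1).
Hypotheses (PP : forall m k, P m -> P k -> P (m * k)) (PV : forall m, P m -> P m^-1).
Hypotheses (MJ : forall v m, M m -> M (v * m * v^-1)).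
Hypotheses (PJ : forall m p, M m -> P p -> P (m * p * m^-1)).
Hypotheses (PQ : forall p q, P p -> Q q -> p * q = q * p).

Let commM v m : M m -> M (comm m v).
Proof. by move=> Mm; rewrite /comm -!mulgA; apply: MM => //; rewrite mulgA; apply/MJ/MV. Qed.

Let commP m p : M m -> P p -> P (comm p m).
Proof. by move=> Mm Pp; rewrite /comm -!mulgA; apply: PP => //; rewrite mulgA; apply/PJ/PV. Qed.

(* If [p] and [q] move [u] off itself then [h, k] = [[q, h^-1], k] is in [M] for
   all [h] and [k] supported in [u]; if moreover [h] and [k] are in [M] then
   [h, k] = [[p, h^-1], k] is in [P], so it commutes with [q] and is trivial. *)
Lemma commuting_normal_disj p q : P p -> Q q -> disj p q.
Proof.
move=> Pp Qq; apply: contrapT => /not_disj[x [/moved_off[N HN] /moved_off[N' HN']]].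
pose u := mkseq x (maxn N N').
have pu : moves_off p u by apply: HN; exact: leq_maxl.
have qu : moves_off q u by apply: HN'; exact: leq_maxr.
apply: (@rist_not_metabelian u M) => h k uh uk.
  rewrite -[h]invgK -(comm_moves_off qu) //; last exact: rist_inv.
  by apply/commM/commM/QM.
move=> Mh Mk; set c := comm h k.
have Pc : P c.
  rewrite /c -[h]invgK -(comm_moves_off pu) //; last exact: rist_inv.
  by apply: commP => //; apply: commP => //; exact: MV.
apply: thompsonV_eq => z; have cu : rist u c by exact: rist_comm.
case: (pselect (sdi u z)) => [uz|]; last exact: cu.
apply: (@tv_inj q); have := congr1 (fun v : thompsonV => v z) (PQ Pc Qq).
by rewrite (tv_mulE c q) (tv_mulE q c) (cu _ (qu _ uz)) => <-.
Qed.

(** Let [p] move [x] and [q] move [y]. Let [t] fix [x] and carry [p x] close to [y]. Then [m], the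
    conjugate of [p] by [t], is in [M] and carries [x] close to [y]; so the conjugate of [p] by [m],
    which is in [P], moves a point that [q] moves, against disjointness. *)
Lemma commuting_normal_trivial p q : P p -> Q q -> p <> 1 -> q = 1.
Proof.
move=> Pp Qq p1; apply: contrapT => q1.
have moved v : v <> 1 -> exists z : cantor_space, (v : thompsonV) z <> z.
  by move=> v1; apply/existsNP => h; apply/v1/thompsonV_eq.
have [[x px] [y qy]] := (moved p p1, moved q q1).
have nPQ p' q' z : P p' -> Q q' -> p' z <> z -> q' z <> z -> False.
  by move=> Pp' Qq' pz qz; case: (commuting_normal_disj Pp' Qq' z).
(* Both [x] and [p x] are moved by [p], so by disjointness neither of them is [y]. *)
have ppx : p (p x) <> p x by move=> /tv_inj.
have [N HN] := tv_moved qy.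
have [|N1 d1] := @neq_agree (p x) y.
  by move=> e; apply: nPQ Pp Qq ppx _; rewrite e.
have [|N2 d2] := @neq_agree y x.
  by move=> e; apply: nPQ Pp Qq px _; rewrite -e.
have [N3 d3] := neq_agree px.
pose n := maxn N (maxn N1 (maxn N2 N3)).
have [n0 n1 n2 n3] : [/\ N <= n, N1 <= n, N2 <= n & N3 <= n]%N.
  by rewrite /n; split; rewrite !leq_max leqnn ?orbT.
pose a := mkseq (p x) n; pose b := mkseq y n; pose t := swap a b.
have ab : incomp a b.
  apply: disj_incomp => z /sdi_mkseqP az /sdi_mkseqP bz.
  by apply: (d1 n n1) => i iN; rewrite -bz // az.
have tx : t x = x by apply: swap_out => /sdi_mkseqP; [exact: d3 n3|exact: d2 n2].
have btx : sdi b (t (p x)).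
  by rewrite -(prepend_shift (sdi_mkseq n (p x))) swapL //; exact: sdi_prepend.
pose m := t * p * t^-1; have mx : m x = t (p x).
  by rewrite /m (tv_mulE (t * p)) (tv_mulE t p) swapV tx.
have bmx : sdi b (m x) by rewrite mx.
apply: (nPQ (m * p * m^-1) q (m x)) => //; first by apply: PJ => //; apply/MJ/PM.
  by rewrite (tv_mulE (m * p)) (tv_mulE m p) tvK => /tv_inj.
by move/sdi_mkseqP: bmx => bmy; exact: (HN _ _ _ n0 bmy bmy).
Qed.
End CommutingNormal.

(** * Loops *)

Lemma aut1 (G : groupType) (f : automorphism G) : f 1 = 1.
Proof. exact: morph1 (@aut_mul _ f). Qed.
Lemma autV (G : groupType) (f : automorphism G) x : f x^-1 = (f x)^-1.
Proof. exact: morphV (@aut_mul _ f) x. Qed.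

Section Loops.
Variable G : groupType.
Implicit Types (a b : loop_group G) (m p : seq bool).

Lemma loop_mulE a b x : (a * b) x = a x * b x.
Proof. by []. Qed.
Lemma loop_invE a x : a^-1 x = (a x)^-1.
Proof. by []. Qed.

Definition supp_in m a := forall x, ~ sdi m x -> a x = 1.

Lemma supp_in_mul m a b : supp_in m a -> supp_in m b -> supp_in m (a * b).
Proof. by move=> ma mb x mx; rewrite loop_mulE ma // mb // mulg1. Qed.
Lemma supp_in_inv m a : supp_in m a -> supp_in m a^-1.
Proof. by move=> ma x mx; rewrite loop_invE ma // invg1. Qed.
Lemma supp_in_conj m a b : supp_in m a -> supp_in m (b * a * b^-1).
Proof. by move=> ma x mx; rewrite !loop_mulE ma // mulg1 mulgV. Qed.

Lemma supp_in_cat m p a : supp_in (m ++ p) a -> supp_in m a.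
Proof. by move=> ma x mx; apply: ma => /sdi_cat. Qed.

Lemma supp_in_commute m p a b : incomp m p -> supp_in m a -> supp_in p b ->
  a * b = b * a.
Proof.
move=> mp ma pb; apply: loop_group_eq => x; rewrite !loop_mulE.
by case: (pselect (sdi m x)) => [/(incompP mp)/pb->|/ma->]; rewrite mulg1 mul1g.
Qed.

Definition restr_fun m a x : G := if `[< sdi m x >] then a x else 1.

Lemma restr_loc_const m a : loc_const (restr_fun m a).
Proof.
have /loc_constP[N HN] := loop_loc_const a; apply/loc_constP.
exists (maxn N (size m)) => q; rewrite geq_max => /andP[Nq mq] x y.
have E z : `[< sdi m (prepend q z) >] = prefix m q.
  apply/asboolP/idP => [mz|/prefixP[r ->]]; first exact: sdi_prefix mz (sdi_prepend q z) mq.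
  by rewrite prepend_cat; exact: sdi_prepend.
by rewrite /restr_fun !E; case: ifP => // _; exact: HN.
Qed.

Definition restr m a := LoopGroup (restr_loc_const m a).

Lemma restr_in m a x : sdi m x -> restr m a x = a x.
Proof. by move=> mx; rewrite /= /restr_fun asboolT. Qed.
Lemma restr_supp m a : supp_in m (restr m a).
Proof. by move=> x mx; rewrite /= /restr_fun asboolF. Qed.
Lemma restr_id m a : supp_in m a -> restr m a = a.
Proof.
move=> ma; apply: loop_group_eq => x; case: (pselect (sdi m x)) => mx.
  by rewrite restr_in.
by rewrite restr_supp // ma.
Qed.
Lemma restrM m : {morph restr m : a b / a * b}.
Proof.
move=> a b; apply: loop_group_eq => x; rewrite loop_mulE.
by case: (pselect (sdi m x)) => mx; [rewrite !restr_in|rewrite !restr_supp ?mulg1].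
Qed.
Lemma restr_disj m p a : incomp m p -> supp_in p a -> restr m a = 1.
Proof.
move=> mp pa; apply: loop_group_eq => x; case: (pselect (sdi m x)) => mx.
  by rewrite restr_in // pa //; exact: incompP mp mx.
exact: restr_supp.
Qed.

Lemma incomp_rcons m : incomp (rcons m false) (rcons m true).
Proof. by rewrite -!cats1 incomp_cat. Qed.

Lemma sdi_rcons m x : sdi m x -> ~ sdi (rcons m false) x -> sdi (rcons m true) x.
Proof.
case=> y _ <-; rewrite -!cats1 -(prepend_mkseq 1 y) /mkseq /= -prepend_cat.
by case: (y 0%N) => // [_|[]]; exact: sdi_prepend.
Qed.

Lemma restr_split m a : restr m a = restr (rcons m false) a * restr (rcons m true) a.
Proof.
apply: loop_group_eq => x; rewrite loop_mulE.
have sm l : sdi (rcons m l) x -> sdi m x by rewrite -cats1 => /sdi_cat.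
case: (pselect (sdi m x)) => mx; last by rewrite !restr_supp ?mulg1 // => /sm.
case: (pselect (sdi (rcons m false) x)) => m0.
  by rewrite (restr_supp a (incompP (incomp_rcons m) m0)) mulg1 !restr_in.
by rewrite (restr_supp a m0) mul1g !restr_in //; exact: sdi_rcons.
Qed.

Lemma restr_nil a : restr [::] a = a.
Proof. by apply: restr_id => x []; exists x => //; rewrite prepend_nil. Qed.

(** By repeated halving, a loop is the product of its restrictions to the pieces of depth [N].
    Identities between homomorphisms can thus be checked on loops with small support. *)
Lemma loop_ind N (W : loop_group G -> Prop) a :
  (forall b c, W b -> W c -> W (b * c)) ->
  (forall m, size m = N -> W (restr m a)) -> W a.
Proof.
move=> WM WN; rewrite -(restr_nil a).
have : (size (Nil bool) + N = N)%N by [].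
move: (Nil bool) {1}N => m k; elim: k m => [|k IH] m mN.
  by apply: WN; rewrite -mN addn0.
by rewrite restr_split; apply: WM; apply: IH; rewrite size_rcons addSnnS.
Qed.
End Loops.

Section Jones.
Variables (G : groupType) (a0 a1 : automorphism G).
Local Notation jones := (jones_map a0 a1).

Lemma jones_supp (v : thompsonV) m p (a : loop_group G) : supp_in m a -> adapted v m p ->
  supp_in p (jones v a).
Proof.
move=> ma vm y py; rewrite -(tvVK v y) jones_mapE ma ?aut1 // => -[z _ e].
by apply: py; rewrite -(tvVK v y) -e vm; exact: sdi_prepend.
Qed.

(** On the support of [a] only the prefix replacement matters, since [tau] is computed from the two
    words. *)
Lemma jones_adapted (v w : thompsonV) m p (a : loop_group G) : supp_in m a ->
  adapted v m p -> adapted w m p -> jones v a = jones w a.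
Proof.
move=> ma vm wm; apply: loop_group_eq => y; case: (pselect (sdi p y)) => [[z _ <-]|py].
  rewrite -{1}(vm z) -(wm z) !jones_mapE.
  by rewrite (tauE _ _ (sdi_prepend m z) vm) (tauE _ _ (sdi_prepend m z) wm).
by rewrite (jones_supp ma vm) // (jones_supp ma wm).
Qed.
End Jones.

(** * Loops and elements of V inside the fraction group *)

Section SemidirectConj.
Variables (N Q : groupType) (phi : {multiplicative Q -> automorphism N}).
Implicit Types u w : semidirect phi.

Definition sd_inl (a : N) : semidirect phi := Semidirect phi a 1.
Definition sd_inr (v : Q) : semidirect phi := Semidirect phi 1 v.

Let phi1 : phi 1 = 1.
Proof. exact: morph1 (@gmulfM _ _ phi). Qed.

Lemma sd_inlM : {morph sd_inl : a b / a * b}.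
Proof. by move=> a b; congr Semidirect => /=; rewrite ?phi1 ?mulg1. Qed.
Lemma sd_inrM : {morph sd_inr : a b / a * b}.
Proof. by move=> a b; congr Semidirect => /=; rewrite aut1 mulg1. Qed.
Lemma sd_split u : u = sd_inl (sd_left u) * sd_inr (sd_right u).
Proof. by case: u => a v; congr Semidirect => /=; rewrite ?phi1 ?mulg1 ?mul1g. Qed.

Lemma sd_inl_conj u a :
  u * sd_inl a * u^-1 = sd_inl (sd_left u * phi (sd_right u) a * (sd_left u)^-1).
Proof.
congr Semidirect => /=; last by rewrite mulg1 mulgV.
by rewrite mulg1 -aut_mulE -gmulfM mulgV phi1.
Qed.
End SemidirectConj.

Section FractionGroup.
Variables (G : groupType) (a0 a1 : automorphism G).

Definition frac_loop (a : loop_group G) : fraction_group a0 a1 :=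
  sd_inl (jones_action a0 a1) a.
Definition frac_tv (v : thompsonV) : fraction_group a0 a1 :=
  sd_inr (jones_action a0 a1) v.
Definition frac_left (u : fraction_group a0 a1) : loop_group G := sd_left u.
Definition frac_right (u : fraction_group a0 a1) : thompsonV := sd_right u.

Lemma frac_loopM : {morph frac_loop : a b / a * b}.
Proof. exact: sd_inlM. Qed.
Lemma frac_tvM : {morph frac_tv : a b / a * b}.
Proof. exact: sd_inrM. Qed.
Lemma frac_rightM : {morph frac_right : u w / u * w}.
Proof. by []. Qed.
Lemma frac_leftM u w :
  frac_left (u * w) = frac_left u * jones_map a0 a1 (frac_right u) (frac_left w).
Proof. by []. Qed.
Lemma frac_split u : u = frac_loop (frac_left u) * frac_tv (frac_right u).
Proof. exact: sd_split. Qed.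
Lemma frac_loop_conj u a : u * frac_loop a * u^-1 =
  frac_loop (frac_left u * jones_map a0 a1 (frac_right u) a * (frac_left u)^-1).
Proof. exact: sd_inl_conj. Qed.
Lemma frac_tv_conj v a :
  frac_tv v * frac_loop a * (frac_tv v)^-1 = frac_loop (jones_map a0 a1 v a).
Proof. by rewrite frac_loop_conj /= invg1 mulg1 mul1g. Qed.
End FractionGroup.

Lemma incomp_letter l : incomp [:: l] [:: ~~ l].
Proof. by case: l. Qed.

Lemma adapted_swap_letter l : adapted (swap [:: l] [:: ~~ l]) [:: l] [:: ~~ l].
Proof. by move=> z; exact/swapL/incomp_letter. Qed.

(** The image of [rho] plays the role of [M], and the images of the loops on the two halves those of
    [P] and [Q]. A swap of the halves makes both images nontrivial as soon as one is, which
    [commuting_normal_trivial] forbids. *)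
Lemma loops_to_loops (G H : groupType) (a0 a1 : automorphism G) (b0 b1 : automorphism H)
    (theta : fraction_group a0 a1 -> fraction_group b0 b1)
    (eta : fraction_group b0 b1 -> fraction_group a0 a1) :
  {morph theta : u w / u * w} -> cancel eta theta ->
  forall a, frac_right (theta (frac_loop a0 a1 a)) = 1.
Proof.
move=> thetaM etaK; pose rho a := frac_right (theta (frac_loop a0 a1 a)).
have thM : {morph (@frac_right H b0 b1 \o theta) : u w / u * w}.
  by move=> u w /=; rewrite thetaM.
have thV u : frac_right (theta u^-1) = (frac_right (theta u))^-1 by exact: (morphV thM).
have rhoM : {morph rho : a b / a * b}.
  by move=> a b; rewrite /rho frac_loopM thetaM.
have rho1 : rho 1 = 1 by exact: morph1.
have rhoV a : rho a^-1 = (rho a)^-1 by exact: (morphV rhoM).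
have rhoJ u a : frac_right (theta u) * rho a * (frac_right (theta u))^-1 =
    rho (frac_left u * jones_map a0 a1 (frac_right u) a * (frac_left u)^-1).
  by rewrite {2}/rho -frac_loop_conj !thetaM !frac_rightM thV.
have swapJ l a : supp_in [:: l] a -> rho a <> 1 ->
    exists b, supp_in [:: ~~ l] b /\ rho b <> 1.
  move=> la ra; pose t := swap [:: l] [:: ~~ l].
  exists (jones_map a0 a1 t a); split; first exact: jones_supp la (@adapted_swap_letter l).
  have := rhoJ (frac_tv a0 a1 t) a; rewrite /= invg1 mulg1 mul1g => <- e; apply: ra.
  move/divg1_eq: e => e; apply: (mulgI (frac_right (theta (frac_tv a0 a1 t)))).
  by rewrite mulg1.
have trivial l a : supp_in [:: l] a -> rho a = 1.
  move=> la; apply: contrapT => ra; have [b [lb rb]] := swapJ l a la ra.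
  pose P l v := exists c, supp_in [:: l] c /\ v = rho c.
  apply: rb; apply: (@commuting_normal_trivial (P l) (P (~~ l)) (fun v => exists c, v = rho c)
    _ _ _ _ _ _ _ _ _ (rho a)) => //.
  - by move=> v [c [_ ->]]; exists c.
  - by move=> v [c [_ ->]]; exists c.
  - by move=> _ _ [c ->] [d ->]; exists (c * d).
  - by move=> _ [c ->]; exists c^-1.
  - move=> _ _ [c [lc ->]] [d [ld ->]]; exists (c * d).
    by split=> //; exact: supp_in_mul.
  - by move=> _ [c [lc ->]]; exists c^-1; split=> //; exact: supp_in_inv.
  (* Normality in the whole of V comes from the surjectivity of [theta]. *)
  - move=> v _ [c ->]; have := rhoJ (eta (frac_tv b0 b1 v)) c; rewrite etaK => ->.
    by eexists.
  - move=> _ _ [d ->] [c [lc ->]]; exists (d * c * d^-1); rewrite !rhoM rhoV.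
    by split=> //; exact: supp_in_conj.
  - move=> _ _ [c [lc ->]] [d [ld ->]]; rewrite -!rhoM; congr rho.
    exact: supp_in_commute (incomp_letter l) lc ld.
  - by exists a.
  - by exists b.
move=> a; rewrite -/(rho a); apply: (@loop_ind _ 1 (fun b => rho b = 1)) => [b c|m].
  by rewrite rhoM => -> ->; rewrite mulg1.
by case: m => [|l [|]] // _; apply: (trivial l); exact: restr_supp.
Qed.

Lemma const_loc_const (G : groupType) (g : G) : loc_const (fun=> g).
Proof. by apply/loc_constP; exists 0%N. Qed.
Definition const_loop (G : groupType) (g : G) := LoopGroup (const_loc_const g).

Lemma const_loopM (G : groupType) : {morph @const_loop G : g h / g * h}.
Proof. by move=> g h; exact: loop_group_eq. Qed.

(** Pushes the half [[:: l]] into the half [[:: k]], hence away from any point whose first letter is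
    not [k]. The base point given to [tv_transitive] only has to avoid both intervals. *)
Lemma exists_letter_push k l : exists v : thompsonV, adapted v [:: l] [:: k; l].
Proof.
have [||v [_ vl]] := @tv_transitive [:: l] [:: k; l] (fun=> ~~ l).
- by move=> /sdi_mkseqE[]; case: l.
- by move=> /sdi_mkseqE[]; case: l.
by exists v.
Qed.

Lemma adapted_cat (v : thompsonV) m p r : adapted v m p -> adapted v (m ++ r) (p ++ r).
Proof. by move=> vm z; rewrite !prepend_cat vm. Qed.

(** * Locality up to a central defect *)

Section LoopEvaluation.
Variables (G H : groupType) (a0 a1 : automorphism G) (x : cantor_space).
Variable e : loop_group G -> H.
Hypothesis eM : {morph e : a b / a * b}.
Hypothesis e_surj : forall h, exists a, e a = h.
Local Notation jones := (jones_map a0 a1).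
Hypothesis eJ : forall v, id_near v x ->
  exists h, forall a, e (jones v a) = h * e a * h^-1.

Let e1 : e 1 = 1. Proof. exact: morph1. Qed.
Let eV a : e a^-1 = (e a)^-1. Proof. exact: morphV. Qed.

Let central (c : H) := forall h, c * h = h * c.

Let centralM c d : central c -> central d -> central (c * d).
Proof. by move=> cc cd h; rewrite -mulgA (cd h) mulgA (cc h) -mulgA. Qed.

(** The conjugation by [h] in [eJ] is undone by a loop [d] with [e d = h^-1]; conjugation by a loop
    does not enlarge supports. *)
Let move_supp m p a : ~ sdi m x -> ~ sdi p x -> supp_in m a ->
  exists b, supp_in p b /\ e b = e a.
Proof.
move=> mx px ma; have [v [vx vm]] := tv_transitive mx px.
have [h hE] := eJ vx; have [d dh] := e_surj h^-1.
exists (d * jones v a * d^-1); split; first exact/supp_in_conj/jones_supp/vm.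
by rewrite !eM eV dh hE invgK -!mulgA mulKg mulVg mulg1.
Qed.

Let k := ~~ x 0%N.

Let kx r : ~ sdi (k :: r) x.
Proof. by move=> /sdi_mkseqE[]; rewrite /k; case: (x 0%N). Qed.

(* Conjugation invariance lets one move the support of [a] off that of [b]. *)
Let central_supp m a : ~ sdi m x -> supp_in m a -> central (e a).
Proof.
move=> mx ma h; have [b <-] := e_surj h.
apply: (@loop_ind _ 1 (fun b => e a * e b = e b * e a)) => [c d ac ad|].
  by rewrite eM mulgA ac -mulgA ad mulgA.
case=> [|l [|]] // _; set c := restr _ _.
have [p [px lp]] : exists p, ~ sdi p x /\ incomp p [:: l].
  case: (eqVneq l k) => [->|lk]; [exists (branch x 1)|exists [:: k]]; split=> //.
  - exact: branch_out.
  - by rewrite /branch /incomp /mkseq /k /=; case: (x 0%N).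
  - by move: lk; rewrite /incomp /=; case: l {c}; case: k.
have [a' [pa' <-]] := move_supp mx px ma.
by rewrite -!eM (supp_in_commute lp pa' (@restr_supp _ _ _)).
Qed.

Let push l : thompsonV := sval (cid (exists_letter_push k l)).
Let pushP l : adapted (push l) [:: l] [:: k; l].
Proof. exact: svalP (cid (exists_letter_push k l)). Qed.

Let z_part l a := e (jones (push l) (restr [:: l] a)).

Let z_partC l a : central (z_part l a).
Proof.
by apply: (@central_supp [:: k; l]) => //; exact: jones_supp (@restr_supp _ _ _) (pushP l).
Qed.

Let z_partM l : {morph z_part l : a b / a * b}.
Proof. by move=> a b; rewrite /z_part restrM jones_map_mul eM. Qed.

(** Each half of [a] is pushed away from [x] before evaluation. This extends to all loops the
    restriction of [e] to the loops trivial at [x], see [zeta_trivial]. *)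
Let zeta a := z_part false a * z_part true a.

Let zetaM : {morph zeta : a b / a * b}.
Proof.
move=> a b; rewrite /zeta !z_partM -!mulgA; congr (_ * _); rewrite !mulgA; congr (_ * _).
exact: z_partC.
Qed.

Let zetaC a : central (zeta a).
Proof. by apply: centralM; exact: z_partC. Qed.

Let z_part_restr l m a : supp_in (l :: m) a -> zeta a = e (jones (push l) a).
Proof.
move=> ma; have la : supp_in [:: l] a by exact: (@supp_in_cat _ [:: l] m).
have ra : restr [:: ~~ l] a = 1 by apply: restr_disj la; case: (l).
rewrite /zeta; case: l ma la ra => ma la ra; rewrite /z_part (restr_id la) ra.
  by rewrite (morph1 (@jones_map_mul _ a0 a1 _)) e1 mul1g.
by rewrite (morph1 (@jones_map_mul _ a0 a1 _)) e1 mulg1.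
Qed.

(** The choice of the push is immaterial: two moves to intervals missing [x] differ by some [w] with
    trivial germ at [x], which changes [e] by a conjugation, and the value is central. A nonempty
    [m] lies in a single half. *)
Let zeta_adapted m p (v : thompsonV) a : m != [::] -> supp_in m a -> adapted v m p -> ~ sdi p x ->
  zeta a = e (jones v a).
Proof.
case: m => [//|l m] _ ma vm px; rewrite (z_part_restr ma).
have pm : adapted (push l) (l :: m) (k :: l :: m) by exact: (adapted_cat m (pushP l)).
have [w [wx wm]] := tv_transitive (@kx (l :: m)) px.
have [h hE] := eJ wx.
have -> : jones v a = jones w (jones (push l) a).
  rewrite -jones_mapM; apply: jones_adapted ma vm _ => z.
  by rewrite tv_mulE pm wm.
by rewrite hE -(central_supp _ (jones_supp a0 a1 ma pm)) ?mulgK //.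
Qed.

Let zeta_trivial (a : loop_group G) : a x = 1 -> zeta a = e a.
Proof.
move=> ax; have /loc_constP[N HN] := loop_loc_const a.
apply: (@loop_ind _ N.+1 (fun b => zeta b = e b)) => [b c|m mN].
  by rewrite eM zetaM => -> ->.
case: (pselect (sdi m x)) => mx; last first.
  rewrite -[in RHS](jones_map1 a0 a1 (restr m a)).
  apply: (@zeta_adapted m m) => //; last exact: restr_supp.
  by case: (m) mN.
suff -> : restr m a = 1 by rewrite e1 morph1.
apply: loop_group_eq => z; case: (pselect (sdi m z)) => [mz|]; last exact: restr_supp.
rewrite restr_in //; case: mx mz => [y _ xy] [t _ <-].
by rewrite (HN m _ t y) ?mN // xy.
Qed.

Let zetaJ v a : zeta (jones v a) = zeta a.
Proof.
have [N HN] := sdp_map_level (tv_sdp_map v).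
(* [v] rewrites the first [N] letters, and the extra letter survives in the image word [q], which is
   therefore nonempty. Both sides then evaluate the loop moved by [push l * v]. *)
apply: (@loop_ind _ N.+1 (fun b => zeta (jones v b) = zeta b)) => [b c|m mN].
  by rewrite jones_map_mul !zetaM => -> ->.
have [|p vp] := HN (take N m); first by rewrite size_takel // mN.
have vm := adapted_cat (drop N m) vp; rewrite cat_take_drop in vm.
set b := restr m a; have mb : supp_in m b by exact: restr_supp.
set q := p ++ drop N m in vm.
have q0 : q != [::] by rewrite -size_eq0 size_cat size_drop mN subSnn addnS.
case eq: q q0 => [//|l r] _; rewrite eq in vm.
have pq : adapted (push l) (l :: r) (k :: l :: r) by exact: (adapted_cat r (pushP l)).
rewrite (zeta_adapted _ (jones_supp a0 a1 mb vm) pq) // -jones_mapM.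
apply: esym; apply: (@zeta_adapted m (k :: l :: r) (push l * v) b) => [||z|] //.
  by case: (m) mN.
by rewrite tv_mulE vm pq.
Qed.

(** [kappa g] is the value of [e] on the constant loop [g], corrected by its defect. Dividing [a] by
    the constant loop [a x] gives a loop trivial at [x], where [zeta] and [e] agree. *)
Lemma loop_evaluation : exists (kappa : G -> H) (zeta : loop_group G -> H),
  [/\ {morph kappa : g h / g * h}, {morph zeta : a b / a * b},
      forall a h, zeta a * h = h * zeta a,
      forall v a, zeta (jones v a) = zeta a &
      forall a, e a = kappa (a x) * zeta a].
Proof.
exists (fun g => e (const_loop g) * (zeta (const_loop g))^-1), zeta; split=> //.
- move=> g h; rewrite const_loopM eM zetaM.
  have zV c d : (zeta c)^-1 * d = d * (zeta c)^-1 by apply/esym/commuteV; rewrite /commute zetaC.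
  by rewrite invgM -[in LHS]zV -!mulgA; congr (_ * _); rewrite !mulgA zV.
move=> a; pose c := const_loop (a x).
have r1 : (c^-1 * a) x = 1 by rewrite loop_mulE loop_invE mulVg.
have := zeta_trivial r1; rewrite eM eV zetaM (morphV zetaM) -mulgA => ->.
by rewrite mulVKg.
Qed.
End LoopEvaluation.

(** * Isomorphisms of fraction groups *)

Lemma jones_id_near (G : groupType) (a0 a1 : automorphism G) v (a : loop_group G) y :
  id_near v y -> jones_map a0 a1 v a y = a y.
Proof.
move=> [N HN]; have vy : v y = y by exact: HN.
rewrite -{1}vy jones_mapE (@tauE _ _ _ _ _ (mkseq y N) (mkseq y N)) ?mulVg //.
  exact: sdi_mkseq.
by move=> z; apply: HN; apply/sdi_mkseqP; exact: sdi_prepend.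
Qed.

Lemma id_near_conj v w x : id_near w x -> id_near (v * w * v^-1) (v x).
Proof.
move=> [N HN]; pose A := [set z : cantor_space | w z = z].
have /nbhs_cantorP[M HM] : nbhs (v x) [set z | A (tv_fun v^-1 z)].
  have := @tv_fun_continuous v^-1 (v x) A; rewrite tvK; apply.
  by apply: filterS (nbhs_cyl x N) => z; exact: HN.
exists M => z /HM wz; have {}wz : w (tv_fun v^-1 z) = tv_fun v^-1 z by exact: wz.
by rewrite -[LHS]/(v (w (tv_fun v^-1 z))) wz [LHS]tvVK.
Qed.

Section Inner.
Variable G : groupType.

Lemma inner1 : inner (1 : automorphism G).
Proof. by exists 1 => x; rewrite mul1g invg1 mulg1. Qed.
Lemma inner_mul (f g : automorphism G) : inner f -> inner g -> inner (f * g).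
Proof.
move=> [h fh] [k gk]; exists (h * k) => x.
by rewrite aut_mulE gk fh invgM !mulgA.
Qed.
Lemma inner_inv (f : automorphism G) : inner f -> inner f^-1.
Proof.
move=> [h fh]; exists h^-1 => x; apply: (can_inj (aut_funK f)).
by rewrite [LHS](aut_invK f) fh invgK !mulgA mulgV mul1g mulgK.
Qed.
Lemma inner_alpha_word (a0 a1 : automorphism G) m :
  inner a0 -> inner a1 -> inner (alpha_word a0 a1 m).
Proof.
move=> i0 i1; elim/last_ind: m => [|m l IH]; first exact: inner1.
rewrite -cats1 alpha_word_cat; apply: inner_mul => //.
by apply: inner_mul; [case: l|exact: inner1].
Qed.
Lemma inner_tau (a0 a1 : automorphism G) v x :
  inner a0 -> inner a1 -> inner (tau a0 a1 v x).
Proof.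
by move=> i0 i1; apply: inner_mul; [apply: inner_inv|]; exact: inner_alpha_word.
Qed.
End Inner.

Section Iso.
Variables (G H : groupType) (a0 a1 : automorphism G) (b0 b1 : automorphism H).
Implicit Types (theta : fraction_group a0 a1 -> fraction_group b0 b1).

Definition loop_part theta a := frac_left (theta (frac_loop a0 a1 a)).
Definition tv_part theta v := frac_right (theta (frac_tv a0 a1 v)).
(** The loop that measures how far [loop_part] is from intertwining the two Jones actions, see
    [loop_partJ]. *)
Definition tv_cocycle theta v := frac_left (theta (frac_tv a0 a1 v)).
End Iso.

Section IsoParts.
Variables (G H : groupType) (a0 a1 : automorphism G) (b0 b1 : automorphism H).
Variables (theta : fraction_group a0 a1 -> fraction_group b0 b1)
  (eta : fraction_group b0 b1 -> fraction_group a0 a1).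
Hypotheses (thetaM : {morph theta : u w / u * w}) (etaM : {morph eta : u w / u * w})
  (thetaK : cancel theta eta) (etaK : cancel eta theta).

Lemma theta_loop a : theta (frac_loop a0 a1 a) = frac_loop b0 b1 (loop_part theta a).
Proof.
rewrite (frac_split (theta _)) (loops_to_loops thetaM etaK).
by rewrite (morph1 (@frac_tvM _ b0 b1)) mulg1.
Qed.

Lemma theta_tv v : theta (frac_tv a0 a1 v) =
  frac_loop b0 b1 (tv_cocycle theta v) * frac_tv b0 b1 (tv_part theta v).
Proof. exact: frac_split. Qed.

Lemma frac_loop_inj (K : groupType) (c0 c1 : automorphism K) : injective (frac_loop c0 c1).
Proof. by move=> a b []. Qed.

Lemma loop_partM : {morph loop_part theta : a b / a * b}.
Proof.
by move=> a b; apply: (@frac_loop_inj _ b0 b1); rewrite -theta_loop !frac_loopM thetaM !theta_loop.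
Qed.

Lemma tv_partM : {morph tv_part theta : v w / v * w}.
Proof. by move=> v w; rewrite /tv_part frac_tvM thetaM. Qed.

Lemma loop_partJ v a : loop_part theta (jones_map a0 a1 v a) =
  tv_cocycle theta v * jones_map b0 b1 (tv_part theta v) (loop_part theta a)
    * (tv_cocycle theta v)^-1.
Proof.
apply: (@frac_loop_inj _ b0 b1); rewrite -theta_loop -frac_tv_conj !thetaM (morphV thetaM).
by rewrite theta_loop frac_loop_conj.
Qed.
End IsoParts.

Section IsoInverse.
Variables (G H : groupType) (a0 a1 : automorphism G) (b0 b1 : automorphism H).
Variables (theta : fraction_group a0 a1 -> fraction_group b0 b1)
  (eta : fraction_group b0 b1 -> fraction_group a0 a1).
Hypotheses (thetaM : {morph theta : u w / u * w}) (etaM : {morph eta : u w / u * w})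
  (thetaK : cancel theta eta) (etaK : cancel eta theta).

Lemma loop_partK : cancel (loop_part theta) (loop_part eta).
Proof.
move=> a; apply: (@frac_loop_inj _ a0 a1).
by rewrite -(theta_loop etaM thetaK) -(theta_loop thetaM etaK) thetaK.
Qed.

Lemma tv_partK : cancel (tv_part theta) (tv_part eta).
Proof.
move=> v; rewrite {1}/tv_part.
have -> : frac_tv b0 b1 (tv_part theta v) =
    (frac_loop b0 b1 (tv_cocycle theta v))^-1 * theta (frac_tv a0 a1 v).
  by rewrite theta_tv mulKg.
rewrite etaM thetaK -(morphV (@frac_loopM _ b0 b1)) frac_rightM.
by rewrite (loops_to_loops etaM thetaK) mul1g.
Qed.

(* [kappa] is the fibre map at [x]; [zeta] is the central, invariant defect of
   locality. *)
Definition is_evaluation x y (kappa : G -> H) (zeta : loop_group G -> H) :=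
  [/\ {morph kappa : g h / g * h}, {morph zeta : a b / a * b},
      forall a h, zeta a * h = h * zeta a,
      forall v a, zeta (jones_map a0 a1 v a) = zeta a &
      forall a, loop_part theta a y = kappa (a x) * zeta a].

(** If [v] is trivial near [x], then [tv_part theta v] is trivial near [y] and its Jones action
    keeps values at [y]; only conjugation by the cocycle remains. *)
Lemma exists_evaluation x y :
  (forall v, id_near v x <-> id_near (tv_part theta v) y) ->
  exists kappa zeta, is_evaluation x y kappa zeta.
Proof.
move=> xy; apply: (@loop_evaluation _ _ a0 a1 x (fun a => loop_part theta a y)).
- by move=> a b; rewrite (loop_partM thetaM etaK).
- move=> h; exists (loop_part eta (const_loop h)).
  have eqK : cancel (loop_part eta) (loop_part theta).
    move=> b; apply: (@frac_loop_inj _ b0 b1).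
    by rewrite -(theta_loop thetaM etaK) -(theta_loop etaM thetaK) etaK.
  by rewrite eqK.
- move=> v /xy vy; exists (tv_cocycle theta v y) => a.
  by rewrite (loop_partJ thetaM etaK) !loop_mulE loop_invE (jones_id_near _ _ _ vy).
Qed.
End IsoInverse.

Lemma isomorphic_of_bij (G H : groupType) (f : G -> H) :
  {morph f : g h / g * h} -> bijective f -> isomorphic G H.
Proof.
move=> fM bf.
by exists (HB.pack_for {multiplicative G -> H} f (isMultiplicative.Build G H f fM)).
Qed.

Section IsoFibres.
Variables (G H : groupType) (a0 a1 : automorphism G) (b0 b1 : automorphism H).
Variables (theta : fraction_group a0 a1 -> fraction_group b0 b1)
  (eta : fraction_group b0 b1 -> fraction_group a0 a1).
Hypotheses (thetaM : {morph theta : u w / u * w}) (etaM : {morph eta : u w / u * w})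
  (thetaK : cancel theta eta) (etaK : cancel eta theta).

(* An invariant [zeta] kills [c * (v c v^-1)^-1], and so does its pullback by
   [eta]; such loops take every value at [y]. *)
Lemma evaluationK x y kappa zeta kappa' zeta' :
  is_evaluation theta x y kappa zeta -> is_evaluation eta y x kappa' zeta' ->
  cancel kappa' kappa.
Proof.
move=> [kM zM zC zJ kE] [k'M z'M z'C z'J k'E] h.
pose l := y 0%N; pose t := swap [:: l] [:: ~~ l].
pose c := restr [:: l] (const_loop h); pose b := c * (jones_map b0 b1 t c)^-1.
have yl : sdi [:: l] y by exact: (sdi_mkseq 1 y).
have by_h : b y = h.
  rewrite loop_mulE loop_invE [c y]restr_in //.
  have -> : jones_map b0 b1 t c y = 1.
    apply: (jones_supp b0 b1 (@restr_supp _ _ _) (@adapted_swap_letter l)).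
    exact: incompP (incomp_letter l) yl.
  by rewrite invg1 mulg1.
have z'b : zeta' b = 1 by rewrite z'M (morphV z'M) z'J mulgV.
have zb : zeta (loop_part eta b) = 1.
  rewrite (loop_partM etaM thetaK) (morphV (loop_partM etaM thetaK)) (loop_partJ etaM thetaK).
  rewrite zM (morphV zM) !zM zJ (morphV zM) -[zeta (tv_cocycle _ _) * _]zC.
  by rewrite mulgK mulgV.
have := kE (loop_part eta b); rewrite zb mulg1 k'E z'b mulg1 by_h => <-.
by rewrite (loop_partK etaM thetaM etaK thetaK).
Qed.
End IsoFibres.

Section Isomorphism.
Variables (G H : groupType) (a0 a1 : automorphism G) (b0 b1 : automorphism H).
Variables (theta : fraction_group a0 a1 -> fraction_group b0 b1)
  (eta : fraction_group b0 b1 -> fraction_group a0 a1).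
Hypotheses (thetaM : {morph theta : u w / u * w}) (etaM : {morph eta : u w / u * w})
  (thetaK : cancel theta eta) (etaK : cancel eta theta).

Let phiK : cancel (tv_part theta) (tv_part eta).
Proof. exact: (tv_partK etaM thetaK). Qed.
Let psiK : cancel (tv_part eta) (tv_part theta).
Proof. exact: (tv_partK thetaM etaK). Qed.

Lemma exists_fibre_iso x : exists y kappa kappa' zeta,
  [/\ forall v, id_near v x <-> id_near (tv_part theta v) y,
      is_evaluation theta x y kappa zeta, cancel kappa kappa' & cancel kappa' kappa].
Proof.
have [y xy] := id_near_iso x (tv_partM thetaM) phiK psiK.
have yx v : id_near v y <-> id_near (tv_part eta v) x.
  by rewrite -[in X in X <-> _](psiK v); apply: iff_sym.
have [kappa [zeta k]] := exists_evaluation thetaM etaM thetaK etaK xy.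
have [kappa' [zeta' k']] := exists_evaluation etaM thetaM etaK thetaK yx.
exists y, kappa, kappa', zeta; split=> //.
  exact: evaluationK etaM thetaM etaK thetaK _ _ _ _ _ _ k' k.
exact: evaluationK thetaM etaM thetaK etaK _ _ _ _ _ _ k k'.
Qed.

Lemma fraction_iso_base : isomorphic G H.
Proof.
have [y [k [k' [z [_ [kM _ _ _ _] kK k'K]]]]] := exists_fibre_iso point.
exact: isomorphic_of_bij kM (Bijective kK k'K).
Qed.

(** At the constant sequence [l], the element replacing the prefix [ll] by [l] has as [tau] exactly
    the automorphism of index [l]. The isomorphism [k] conjugates it to an inner automorphism. *)
Lemma fraction_iso_inner l : inner b0 -> inner b1 -> inner (if l then a1 else a0).
Proof.
move=> i0 i1; pose x : cantor_space := fun=> l.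
have px m : prepend (nseq m l) x = x.
  by apply: funext => n; rewrite /prepend; elim: m n => [|m IH] [|n] //=; rewrite ?IH.
have [||v [_ vx]] := @tv_transitive [:: l; l] [:: l] (fun=> ~~ l).
- by move=> /sdi_mkseqE[]; case: (l).
- by move=> /sdi_mkseqE[]; case: (l).
have fx : v x = x by rewrite -{1}(px 2%N) vx (px 1%N).
have fxV : (v^-1 : thompsonV) x = x by rewrite -{1}fx tvK.
have [y [k [k' [z [xy [kM zM zC zJ kE] kK k'K]]]]] := exists_fibre_iso x.
(* As [v] fixes [x], conjugation by it preserves the elements with trivial germ at [x]; so their
   images have trivial germs at both [y] and [tv_part theta v y]. *)
have fy : tv_part theta v y = y.
  apply/esym/id_near_unique => u; rewrite -(psiK u) -xy => /(id_near_conj v^-1).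
  rewrite fxV xy => /(id_near_conj (tv_part theta v)).
  rewrite !(tv_partM thetaM) (morphV (tv_partM thetaM)) invgK.
  by rewrite !mulgA mulgV mul1g mulgK.
have [h hE] := inner_tau (tv_part theta v) y i0 i1.
have tE g : k (tau a0 a1 v x g) = (tv_cocycle theta v y * h) * k g * (tv_cocycle theta v y * h)^-1.
  (* The loop and its transform under [v] have the same central defect, which cancels. *)
  pose a := const_loop g; have := kE (jones_map a0 a1 v a).
  rewrite -{1}fx jones_mapE zJ (loop_partJ thetaM etaK) !loop_mulE loop_invE.
  rewrite -{2}fy jones_mapE hE kE.
  set c := tv_cocycle theta v y => e; apply: (mulIg (z a)); rewrite -[LHS]e.
  rewrite invgM -!mulgA; do 3!congr (_ * _); rewrite zC.
  by rewrite -mulgA.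
have lE : tau a0 a1 v x = if l then a1 else a0.
  rewrite (@tauE _ _ _ _ _ [:: l; l] [:: l]) //; first by rewrite /alpha_word /= mulg1 mulKg.
  by rewrite -(px 2%N); exact: sdi_prepend.
suff : inner (tau a0 a1 v x) by rewrite lE.
exists (k' (tv_cocycle theta v y * h)) => g; apply: (can_inj kK).
by rewrite tE !kM (morphV kM) k'K.
Qed.
End Isomorphism.

(** * Cohomologous actions *)

Section CohomologousActions.
Variables (G H : groupType) (a0 a1 : automorphism G) (b0 b1 : automorphism H).
Variables (f : G -> H) (f' : H -> G) (h : bool -> H).
Hypotheses (fM : {morph f : x y / x * y}) (fK : cancel f f') (f'K : cancel f' f).
Hypothesis fh : forall l g,
  f ((if l then a1 else a0) g) = h l * (if l then b1 else b0) (f g) * (h l)^-1.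

(** Extends [h] to words: conjugation by it compares the two automorphisms of the word [m], see
    [word_cocycleP]. *)
Definition word_cocycle (m : seq bool) : H :=
  foldl (fun c l => h l * (if l then b1 else b0) c) 1 m.

Local Notation hw := word_cocycle.
Local Notation aw := (alpha_word a0 a1).
Local Notation bw := (alpha_word b0 b1).

Lemma alpha_word_rcons (K : groupType) (c0 c1 : automorphism K) m l x :
  alpha_word c0 c1 (rcons m l) x = (if l then c1 else c0) (alpha_word c0 c1 m x).
Proof. by rewrite -cats1 alpha_word_cat. Qed.

Lemma word_cocycle_rcons m l : hw (rcons m l) = h l * (if l then b1 else b0) (hw m).
Proof. by rewrite /hw foldl_rcons. Qed.

Lemma word_cocycle_cat m p : hw (m ++ p) = hw p * bw p (hw m).
Proof.
elim/last_ind: p => [|p l IH]; first by rewrite cats0 mul1g.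
by rewrite -rcons_cat !word_cocycle_rcons IH aut_mul alpha_word_rcons mulgA.
Qed.

Lemma word_cocycleP m g : f (aw m g) = hw m * bw m (f g) * (hw m)^-1.
Proof.
elim/last_ind: m => [|m l IH]; first by rewrite mul1g invg1 mulg1.
rewrite !alpha_word_rcons fh IH word_cocycle_rcons !aut_mul autV invgM.
by rewrite !mulgA.
Qed.

(** The conjugator between the two [tau], found by moving the word cocycles through the inverse of
    [bw mm.2]. The chosen interval is immaterial by [tv_defectE]. *)
Definition tv_defect (v : thompsonV) x : H :=
  let mm := sval (cid (adapted_at v x)) in
  aut_inv (bw mm.2) ((hw mm.2)^-1 * hw mm.1).

Lemma tv_defectE (v : thompsonV) x m m' : sdi m x -> adapted v m m' ->
  tv_defect v x = aut_inv (bw m') ((hw m')^-1 * hw m).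
Proof.
rewrite /tv_defect; case: cid => -[p p'] /= [].
wlog le : m m' p p' / (size m <= size p)%N => [hwl|] px vp mx vm.
  case/orP: (leq_total (size m) (size p)) => ?; first exact: hwl.
  by symmetry; apply: hwl.
case: mx px => [y _ ey] [z _ ez].
have [r [ep _]] := prepend_eq (etrans ey (esym ez)) le.
have ep' : p' = m' ++ r.
  by apply: prepend_word_inj => t; rewrite -vp ep !prepend_cat vm.
rewrite ep ep' !word_cocycle_cat alpha_word_cat.
rewrite -[LHS]/(aut_inv (bw m') (aut_inv (bw r) _)); congr aut_inv.
by rewrite invgM -mulgA mulKg -autV -aut_mul aut_funK.
Qed.

Lemma tv_defectP v x g :
  f (tau a0 a1 v x g) = tv_defect v x * tau b0 b1 v x (f g) * (tv_defect v x)^-1.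
Proof.
have [[m m'] [mx vm]] := adapted_at v x.
have {}mx : sdi m x := mx; have {}vm : adapted v m m' := vm.
rewrite (tv_defectE mx vm) (tauE a0 a1 mx vm) (tauE b0 b1 mx vm).
apply: (can_inj (aut_funK (bw m'))); rewrite !aut_mul autV aut_invK.
rewrite !aut_mulE [X in _ = _ * X * _](aut_invK (bw m')).
have := word_cocycleP m' ((aw m')^-1 (aw m g)); rewrite [aw m' _](aut_invK (aw m')).
rewrite word_cocycleP => e.
move: (bw m' _) e => X e.
have -> : X = (hw m')^-1 * (hw m' * X * (hw m')^-1) * hw m'.
  by rewrite !mulgA mulVg mul1g mulgVK.
by rewrite -e invgM invgK !mulgA.
Qed.

(** Comparing inner automorphisms would give this only up to the centre. The formula on words gives
    it exactly, since the cocycle of the intermediate word cancels. *)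
Lemma tv_defectM v w x :
  tv_defect (v * w) x = tv_defect v (w x) * tau b0 b1 v (w x) (tv_defect w x).
Proof.
have [N HN] := adapted_comp (tv_sdp_map v) (tv_sdp_map w).
have [|m' [m'' [wm vm]]] := HN (mkseq x N); first by rewrite size_mkseq.
have mx := sdi_mkseq N x.
have mwx : sdi m' (w x) by case: mx => y _ <-; rewrite wm; exists y.
have vwm : adapted (v * w) (mkseq x N) m'' by move=> y /=; rewrite wm vm.
rewrite (tv_defectE mx vwm) (tv_defectE mx wm) (tv_defectE mwx vm) (tauE _ _ mwx vm).
rewrite aut_mulE aut_invK -[X in _ = _ * X]/(aut_inv (bw m'') _) -(aut_mul (aut_sym (bw m''))) /=.
congr aut_inv.
by rewrite -mulgA mulVKg.
Qed.

Lemma defect_loc_const v : loc_const (fun y => tv_defect v (tv_fun v^-1 y)).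
Proof.
have /sdp_map_level[N HN] := tv_sdp_map v^-1.
apply/loc_constP; exists N => m /HN[p mp] x y.
have pm : adapted v p m by move=> z; rewrite -mp; exact: tvVK.
by rewrite !mp !(tv_defectE (sdi_prepend p _) pm).
Qed.
Definition defect_loop v := LoopGroup (defect_loc_const v).

Lemma defect_loopE v x : defect_loop v (v x) = tv_defect v x.
Proof. by rewrite -[LHS]/(tv_defect v (tv_fun v^-1 (v x))) tvK. Qed.

Lemma defect_loopM v w :
  defect_loop (v * w) = defect_loop v * jones_map b0 b1 v (defect_loop w).
Proof.
apply: loop_group_eq => y; rewrite -[y](tvVK (v * w)); set x := tv_fun _^-1 y.
rewrite loop_mulE defect_loopE tv_defectM -[(v * w) x]/(v (w x)).
by rewrite defect_loopE jones_mapE defect_loopE.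
Qed.

Lemma map_loc_const (K L : groupType) (k : K -> L) (a : loop_group K) :
  loc_const (fun x => k (a x)).
Proof.
have /loc_constP[N HN] := loop_loc_const a; apply/loc_constP; exists N.
by move=> m /HN e x y; congr k.
Qed.
Definition map_loop (K L : groupType) (k : K -> L) (a : loop_group K) :=
  LoopGroup (map_loc_const k a).

Lemma map_loop_jones v a :
  map_loop f (jones_map a0 a1 v a) * defect_loop v =
  defect_loop v * jones_map b0 b1 v (map_loop f a).
Proof.
apply: loop_group_eq => y; rewrite -[y](tvVK v); set x := tv_fun _^-1 y.
rewrite !loop_mulE defect_loopE jones_mapE.
have -> : map_loop f (jones_map a0 a1 v a) (v x) = f (tau a0 a1 v x (a x)).
  by rewrite -jones_mapE.
by rewrite tv_defectP mulgVK.
Qed.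

(** Applies [f] to the loop part and sends each [v] to its product with the cocycle
    [defect_loop v]. *)
Definition untwist (u : fraction_group a0 a1) : fraction_group b0 b1 :=
  Semidirect (jones_action b0 b1) (map_loop f (frac_left u) * defect_loop (frac_right u))
    (frac_right u).

Definition retwist (u : fraction_group b0 b1) : fraction_group a0 a1 :=
  Semidirect (jones_action a0 a1)
    (map_loop f' (frac_left u * (defect_loop (frac_right u))^-1)) (frac_right u).

Lemma untwistM : {morph untwist : u w / u * w}.
Proof.
move=> u w; congr Semidirect; rewrite frac_rightM frac_leftM defect_loopM.
have mapM a b : map_loop f (a * b) = map_loop f a * map_loop f b.
  by apply: loop_group_eq => x /=; exact: fM.
rewrite mapM [X in _ = _ * X]jones_map_mul !mulgA; congr (_ * _).
by rewrite -mulgA map_loop_jones mulgA.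
Qed.

Lemma untwistK : cancel untwist retwist.
Proof.
case=> a v; congr Semidirect; rewrite /frac_left /frac_right /= mulgK.
by apply: loop_group_eq => x /=; exact: fK.
Qed.

Lemma retwistK : cancel retwist untwist.
Proof.
case=> a v; congr Semidirect; rewrite /frac_left /frac_right /=.
set c := a * _; have -> : map_loop f (map_loop f' c) = c.
  by apply: loop_group_eq => x /=; exact: f'K.
exact: mulgVK.
Qed.

Lemma cohomologous_isomorphic : isomorphic (fraction_group a0 a1) (fraction_group b0 b1).
Proof. exact: isomorphic_of_bij untwistM (Bijective untwistK retwistK). Qed.
End CohomologousActions.

Theorem theoremA (G H : groupType) (a0 a1 : automorphism G)
    (b0 b1 : automorphism H) :
  (isomorphic (fraction_group a0 a1) (fraction_group b0 b1) ->
     isomorphic G H) /\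
  (inner b0 -> inner b1 ->
     (isomorphic (fraction_group a0 a1) (fraction_group b0 b1) <->
        isomorphic G H /\ inner a0 /\ inner a1)).
Proof.
have base : isomorphic (fraction_group a0 a1) (fraction_group b0 b1) ->
    isomorphic G H.
  move=> [theta [eta thetaK etaK]].
  exact: fraction_iso_base (@gmulfM _ _ theta) (can2_gmulfM thetaK etaK) thetaK etaK.
split=> // i0 i1; split=> [iso|[[f [f' fK f'K]] [[g0 e0] [g1 e1]]]].
  split; first exact: base.
  case: iso => theta [eta thetaK etaK].
  have inn l := fraction_iso_inner (@gmulfM _ _ theta) (can2_gmulfM thetaK etaK)
    thetaK etaK l i0 i1.
  by split; [exact: (inn false)|exact: (inn true)].
case: i0 i1 => [k0 d0] [k1 d1].
(* Through [f], conjugation by [g0] becomes conjugation by [f g0], that is [b0] followed by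
   conjugation by [f g0 / k0]; likewise for [g1]. *)
apply: (@cohomologous_isomorphic _ _ _ _ _ _ f f'
  (fun l => if l then f g1 / k1 else f g0 / k0)) => //; first exact: gmulfM.
move=> l g; case: l.
  by rewrite e1 d1 !gmulfM (morphV (@gmulfM _ _ f)) invgM invgK !mulgA !mulgVK.
by rewrite e0 d0 !gmulfM (morphV (@gmulfM _ _ f)) invgM invgK !mulgA !mulgVK.
Qed.
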